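(* Let $X$ be a Gromov product space whose Gromov product boundary $\partial_PX$ has at least four points. Then $X$ is a maximal Gromov product space if and only if $X$ is an injective metric space. In particular, for any antipodal space $Z$, the Moebius space $\mathcal{M}(Z)$ is injective.
   Context: Antipodal spaces and Moebius spaces. Let $Z$ be a compact metrizable space containing at least four points. A separating function on $Z$ is a continuous function $\rho : Z\times Z\to[0,\infty)$ which is symmetric and satisfies $\rho(\xi,\eta)=0$ if and only if $\xi=\eta$. Its cross-ratio is defined on quadruples of distinct points of $Z$ by $[\xi,\xi',\eta,\eta']_\rho=\frac{\rho(\xi,\eta)\rho(\xi',\eta')}{\rho(\xi,\eta')\rho(\xi',\eta)}$. Two separating functions are Moebius equivalent if their cross-ratios agree. If $\rho_1,\rho_2$ are Moebius equivalent, there is a unique positive continuous function $\frac{d\rho_2}{d\rho_1}:Z\to(0,\infty)$, the derivative, such that $\rho_2(\xi,\eta)^2=\frac{d\rho_2}{d\rho_1}(\xi)\frac{d\rho_2}{d\rho_1}(\eta)\rho_1(\xi,\eta)^2$ for all $\xi,\eta\in Z$. An antipodal function on $Z$ is a separating function $\rho$ such that $\sup_{\xi,\eta}\rho(\xi,\eta)=1$ and for every $\xi\in Z$ there is $\eta\in Z$ with $\rho(\xi,\eta)=1$. An antipodal space $(Z,\rho_0)$ is such a space $Z$ equipped with an antipodal function $\rho_0$. Its Moebius space $\mathcal{M}(Z)=\mathcal{M}(Z,\rho_0)$ is the set of all antipodal functions on $Z$ Moebius equivalent to $\rho_0$, with the metric $d_{\mathcal{M}}(\rho_1,\rho_2)=\left\|\log\frac{d\rho_2}{d\rho_1}\right\|_\infty$.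 A map between antipodal spaces is Moebius if it preserves cross-ratios of all quadruples of distinct points. Gromov product spaces. A metric space is proper if closed balls are compact, and geodesically complete if every geodesic segment extends to a bi-infinite geodesic. $(y|z)_x=\frac12(d(x,y)+d(x,z)-d(y,z))$. A proper, geodesic, geodesically complete metric space $X$ is a Gromov product space if there is a second countable Hausdorff compactification $\widehat X$ of $X$ such that for every $x\in X$ the Gromov product $(\cdot|\cdot)_x:X\times X\to[0,+\infty)$ extends to a continuous function $\widehat X\times\widehat X\to[0,+\infty]$ such that for $\xi,\eta\in\widehat X\setminus X$, $(\xi|\eta)_x=+\infty$ if and only if $\xi=\eta$. Such a compactification is unique up to equivalence; it is denoted $\widehat X^P$, and $\partial_PX:=\widehat X^P\setminus X$ is the Gromov product boundary. For $x\in X$ set $\rho_x=e^{-(\cdot|\cdot)_x}$ on $\partial_PX\times\partial_PX$. When $\partial_PX$ has at least four points, the $\rho_x$ are antipodal functions on $\partial_PX$, all Moebius equivalent, and $\partial_PX$ is regarded as an antipodal space with any of them. A Gromov product space $X$ is maximal if for every Gromov product space $Y$ and Moebius homeomorphism $f:\partial_PY\to\partial_PX$, there is an isometric (distance-preserving) embedding $F:Y\to X$ extending $f$, i.e. such that $F\cup f:\widehat Y^P\to\widehat X^P$ is continuous. A metric space $W$ is injective if every $1$-Lipschitz map $A\to W$ from a subset $A$ of a metric space $B$ extends to a $1$-Lipschitz map $B\to W$. *)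

(* Defs.v *)
From HB Require Import structures.
From mathcomp Require Import all_boot all_order all_algebra.
From mathcomp Require Import ring lra.
From mathcomp Require Import all_classical all_reals all_analysis.

Set Implicit Arguments.
Unset Strict Implicit.
Unset Printing Implicit Defensive.

Import Order.TTheory GRing.Theory Num.Theory.
Import numFieldNormedType.Exports.

Local Open Scope classical_set_scope.
Local Open Scope ring_scope.

Definition homeomorphism (T U : topologicalType) (f : T -> U) : Prop :=
  continuous f /\
  exists g : U -> T, [/\ continuous g, cancel f g & cancel g f].

Definition topological_embedding (T U : topologicalType) (f : T -> U) : Prop :=
  injective f /\
  forall A : set T, open A <-> exists2 B : set U, open B & f @^-1` B = A.

Definition metrizable (R : realType) (T : topologicalType) : Prop :=
  exists (M : metricType R) (h : T -> M), homeomorphism h.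

Definition at_least_four_points (T : choiceType) : Prop :=
  exists a b c d : T, uniq [:: a; b; c; d].

(* A function defined on the subset [A] is a function on the subtype of [A];
   with total functions [B -> W] the empty space would count as injective. *)
Definition injective_metric_space (R : realType) (W : metricType R) : Prop :=
  forall (B : metricType R) (A : set B) (f : set_type A -> W),
    (forall a b : set_type A,
       mdist (f a) (f b) <= mdist (set_val a) (set_val b)) ->
    exists g : B -> W,
      (forall x y : B, mdist (g x) (g y) <= mdist x y) /\
      forall a : set_type A, g (set_val a) = f a.

Section Separating.
Context {R : realType}.

Definition separating_function (Z : topologicalType) (rho : Z -> Z -> R) :
    Prop :=
  [/\ continuous (fun p : Z * Z => rho p.1 p.2),
      forall x y, 0 <= rho x y,
      forall x y, rho x y = rho y x
    & forall x y, rho x y = 0 <-> x = y].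

(* Only meaningful on quadruples of distinct points. *)
Definition cross_ratio (Z : Type) (rho : Z -> Z -> R) (x x' y y' : Z) : R :=
  (rho x y * rho x' y') / (rho x y' * rho x' y).

Definition moebius_equivalent (Z : choiceType) (rho1 rho2 : Z -> Z -> R) :
    Prop :=
  forall x x' y y' : Z, uniq [:: x; x'; y; y'] ->
    cross_ratio rho1 x x' y y' = cross_ratio rho2 x x' y y'.

Definition moebius_map (Z1 Z2 : choiceType) (rho1 : Z1 -> Z1 -> R)
    (rho2 : Z2 -> Z2 -> R) (f : Z1 -> Z2) : Prop :=
  forall x x' y y' : Z1, uniq [:: x; x'; y; y'] ->
    cross_ratio rho2 (f x) (f x') (f y) (f y') = cross_ratio rho1 x x' y y'.

(* [sup] is 0 on a set that is empty or unbounded, so that the second clause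
   does say that the least upper bound exists and equals 1. *)
Definition antipodal_function (Z : topologicalType) (rho : Z -> Z -> R) :
    Prop :=
  [/\ separating_function rho,
      sup (range (fun p : Z * Z => rho p.1 p.2)) = 1
    & forall x, exists y, rho x y = 1].

Definition is_derivative (Z : topologicalType) (rho1 rho2 : Z -> Z -> R)
    (D : Z -> R) : Prop :=
  [/\ forall x, 0 < D x, continuous D
    & forall x y, rho2 x y ^+ 2 = D x * D y * rho1 x y ^+ 2].

(* d rho2 / d rho1, chosen among the functions satisfying [is_derivative]: there
   is exactly one when the two functions are Moebius equivalent, see
   [is_derivative_exists] and [is_derivative_unique]. *)
Definition derivative (Z : topologicalType) (rho1 rho2 : Z -> Z -> R) :
    Z -> R :=
  xget (cst 1) [set D | is_derivative rho1 rho2 D].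

End Separating.

Record antipodalSpace (R : realType) := AntipodalSpace {
  antipodal_carrier :> topologicalType;
  antipodal_compact : compact [set: antipodal_carrier];
  antipodal_metrizable : metrizable R antipodal_carrier;
  antipodal_four_points : at_least_four_points antipodal_carrier;
  antipodal_rho : antipodal_carrier -> antipodal_carrier -> R;
  antipodal_rhoP : antipodal_function antipodal_rho }.

Section Derivative.
Context {R : realType} {Z : topologicalType}.
Hypothesis Z4 : at_least_four_points Z.
Implicit Types (r : Z -> Z -> R) (D : Z -> R).

Lemma avoid_two (x y : Z) : exists z, z != x /\ z != y.
Proof.
case: Z4 => a [b [c [d]]]; rewrite /= !inE !negb_or !andbT.
move=> /and3P[/and3P[ab ac ad] /andP[bc bd] cd].
have [ax|ax] := eqVneq a x; have [ay|ay] := eqVneq a y; subst.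
- by exists b; rewrite eq_sym ab.
- have [->|yb] := eqVneq y b; first by exists c; rewrite eq_sym ac eq_sym bc.
  by exists b; rewrite eq_sym ab eq_sym yb.
- have [->|xb] := eqVneq x b; first by exists c; rewrite eq_sym bc eq_sym ac.
  by exists b; rewrite eq_sym xb eq_sym ab.
- by exists a.
Qed.

Lemma separating_gt0 r x y : separating_function r -> x != y -> 0 < r x y.
Proof.
case=> _ r0 _ rE xy; rewrite lt_neqAle r0 andbT eq_sym.
by apply/eqP => /rE; exact/eqP.
Qed.

Lemma is_derivative_unique r1 r2 D D' : separating_function r1 ->
  is_derivative r1 r2 D -> is_derivative r1 r2 D' -> D = D'.
Proof.
move=> s1 [D0 _ DE] [D'0 _ D'E].
have E x y : x != y -> D x * D y = D' x * D' y.
  move=> xy; have /lt0r_neq0 r0 : 0 < r1 x y ^+ 2.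
    by rewrite exprn_gt0// separating_gt0.
  by apply: (mulIf r0); rewrite -DE -D'E.
apply/funext => x.
have [y [yx _]] := avoid_two x x; have [z [zx zy]] := avoid_two x y.
have Exy : D x * D y = D' x * D' y by rewrite E// eq_sym.
have Exz : D x * D z = D' x * D' z by rewrite E// eq_sym.
have Eyz : D y * D z = D' y * D' z by rewrite E// eq_sym.
have /eqP : D x ^+ 2 = D' x ^+ 2.
  have p0 : D y * D z != 0 by rewrite mulf_neq0// gt_eqF.
  apply: (mulIf p0); rewrite [in RHS]Eyz.
  transitivity ((D x * D y) * (D x * D z)); first by ring.
  by rewrite Exy Exz; ring.
by rewrite eqrXn2// ?ltW// => /eqP.
Qed.

Let F r1 r2 (x a b : Z) :=
  r2 x a * r2 x b * r1 a b / (r1 x a * r1 x b * r2 a b).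

Lemma is_derivative_exists r1 r2 : separating_function r1 ->
  separating_function r2 -> moebius_equivalent r1 r2 ->
  exists D, is_derivative r1 r2 D.
Proof.
move=> s1 s2 m12.
have [c1 _ sym1 _] := s1; have [c2 _ sym2 _] := s2.
have n1 x y : x != y -> r1 x y != 0.
  by move=> xy; rewrite gt_eqF// separating_gt0.
have n2 x y : x != y -> r2 x y != 0.
  by move=> xy; rewrite gt_eqF// separating_gt0.
have FC x a b : F r1 r2 x a b = F r1 r2 x b a.
  by rewrite /F (sym1 b a) (sym2 b a) (mulrC (r2 x b)) (mulrC (r1 x b)).
have F1 x a b c : a != x -> b != x -> c != x -> a != b -> a != c ->
    F r1 r2 x a b = F r1 r2 x a c.
  move=> ax bx cx ab ac; have [->//|bc] := eqVneq b c.
  have := m12 x a b c; rewrite /cross_ratio /= !inE !negb_or !andbT.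
  rewrite [x == a]eq_sym [x == b]eq_sym [x == c]eq_sym ax bx cx ab ac bc.
  move=> /(_ isT) E; rewrite /F.
  have xa : x != a by rewrite eq_sym.
  have xb : x != b by rewrite eq_sym.
  have xc : x != c by rewrite eq_sym.
  have E' : r1 x b * r1 a c * (r2 x c * r2 a b) =
            r2 x b * r2 a c * (r1 x c * r1 a b).
    apply/eqP; rewrite -eqr_div ?mulf_neq0 ?n1 ?n2//; exact/eqP.
  apply/eqP; rewrite eqr_div ?mulf_neq0 ?n1 ?n2//; apply/eqP.
  transitivity (r2 x a * r1 x a * (r2 x b * r2 a c * (r1 x c * r1 a b))).
    by ring.
  by rewrite -E'; ring.
have F2 x a b c d : a != x -> b != x -> a != b -> c != x -> d != x -> c != d ->
    F r1 r2 x a b = F r1 r2 x c d.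
  move=> ax bx ab cx dx cd; have [ad|ad] := eqVneq a d.
    by subst d; rewrite (FC x c) (F1 x a b c)// eq_sym.
  by rewrite (F1 x a b d)// FC (FC x c d) (F1 x d a c)// eq_sym.
have /choice[p pP] x : exists p : Z * Z,
    [/\ p.1 != x, p.2 != x & p.1 != p.2].
  have [a [ax _]] := avoid_two x x; have [b [bx ba]] := avoid_two x a.
  by exists (a, b); split => //=; rewrite eq_sym.
pose D x := F r1 r2 x (p x).1 (p x).2.
have DE x a b : a != x -> b != x -> a != b -> D x = F r1 r2 x a b.
  by move=> ax bx ab; have [? ? ?] := pP x; exact: F2.
exists D; split.
- move=> x; have [ax bx ab] := pP x; rewrite /D /F.
  by rewrite divr_gt0// ?mulr_gt0// separating_gt0// eq_sym.
- move=> x; have [ax bx ab] := pP x.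
  have cr r (cr : continuous (fun q : Z * Z => r q.1 q.2)) a :
      {for x, continuous (r^~ a)}.
    apply: (@continuous_comp _ _ _ (fun y => (y, a)) (fun q => r q.1 q.2)).
      by apply: cvg_pair => //=; exact: cvg_cst.
    exact: cr.
  have nz a : a != x -> \forall y \near x, a != y.
    move=> ax'; have : \forall y \near x, 0 < r1 y a.
      apply: (cvgr_gt _ (cr r1 c1 a)).
      by rewrite separating_gt0// eq_sym.
    apply: filterS => y; apply: contraTN => /eqP <-.
    by have [_ _ _ /(_ a a)[_ ->]] := s1; rewrite ?ltxx.
  have FD : \forall y \near x, F r1 r2 y (p x).1 (p x).2 = D y.
    by near=> y; apply/esym/DE => //; near: y; exact: nz.
  apply: (cvg_trans (near_eq_cvg FD)); rewrite (DE x _ _ ax bx ab).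
  apply: cvgM.
    by apply: cvgM; [apply: cvgM; exact: cr|exact: cvg_cst].
  apply: cvgV.
    by rewrite ?mulf_neq0 ?n1 ?n2// eq_sym.
  by apply: cvgM; [apply: cvgM; exact: cr|exact: cvg_cst].
- move=> x y; have [->|xy] := eqVneq x y.
    have [_ _ _ /(_ y y)[_ ->//]] := s1; have [_ _ _ /(_ y y)[_ ->//]] := s2.
    by rewrite expr0n mulr0.
  have [c [cx cy]] := avoid_two x y.
  have yx : y != x by rewrite eq_sym.
  have xc : x != c by rewrite eq_sym.
  have yc : y != c by rewrite eq_sym.
  rewrite (DE x y c)// (DE y x c)// /F (sym1 y x) (sym2 y x).
  have := n1 x y xy; have := n1 x c xc; have := n1 y c yc.
  have := n2 x y xy; have := n2 x c xc; have := n2 y c yc.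
  by move=> *; field; do ?[apply/andP; split].
Unshelve. all: by end_near. Qed.

Lemma derivativeP r1 r2 : separating_function r1 ->
  separating_function r2 -> moebius_equivalent r1 r2 ->
  is_derivative r1 r2 (derivative r1 r2).
Proof.
move=> s1 s2 m12; have [D DP] := is_derivative_exists s1 s2 m12.
exact: (@xgetPex _ (cst 1) [set D | is_derivative r1 r2 D] (ex_intro _ D DP)).
Qed.

End Derivative.

Record moebius_space (R : realType) (Z : antipodalSpace R) := MoebiusSpace {
  moebius_rho :> Z -> Z -> R;
  moebius_rho_antipodal : antipodal_function moebius_rho;
  moebius_rho_equivalent : moebius_equivalent moebius_rho (@antipodal_rho R Z) }.

Definition moebius_dist (R : realType) (Z : antipodalSpace R)
    (rho1 rho2 : moebius_space Z) : R :=
  sup (range (fun z : Z => `|ln (derivative rho1 rho2 z)|)).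

Section MoebiusMetric.
Context {R : realType} {Z : antipodalSpace R}.
Implicit Types r : moebius_space Z.

Let Z4 := @antipodal_four_points R Z.

Lemma moebius_derivativeP r1 r2 : is_derivative r1 r2 (derivative r1 r2).
Proof.
have [s1 _ _] := moebius_rho_antipodal r1.
have [s2 _ _] := moebius_rho_antipodal r2.
apply: derivativeP => //.
by move=> x x' y y' u; rewrite !moebius_rho_equivalent.
Qed.

Lemma moebius_derivativeE r1 r2 D : is_derivative r1 r2 D ->
  derivative r1 r2 = D.
Proof.
move=> DP; have [s1 _ _] := moebius_rho_antipodal r1.
exact: (is_derivative_unique Z4 s1 (moebius_derivativeP r1 r2) DP).
Qed.

Lemma moebius_dist_has_sup r1 r2 :
  has_sup (range (fun z : Z => `|ln (derivative r1 r2 z)|)).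
Proof.
split; first by have [a _] := Z4; exists `|ln (derivative r1 r2 a)|, a.
have [D0 cD _] := moebius_derivativeP r1 r2.
have cl : continuous (fun z : Z => `|ln (derivative r1 r2 z)|).
  move=> z; apply: cvg_norm; apply: continuous_comp; first exact: cD.
  exact: continuous_ln.
have /compact_bounded : compact (range (fun z : Z => `|ln (derivative r1 r2 z)|)).
  apply: continuous_compact; last exact: antipodal_compact.
  exact: continuous_subspaceT.
case=> M [_ /(_ (M + 1))]; rewrite ltrDl ltr01 => /(_ isT) h.
by exists (M + 1) => y /h; exact: le_trans (ler_norm _).
Qed.

Lemma moebius_dist_ub r1 r2 z : `|ln (derivative r1 r2 z)| <= moebius_dist r1 r2.
Proof.
by apply: ub_le_sup; [case: (moebius_dist_has_sup r1 r2)|exists z].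
Qed.

Lemma moebius_dist_lub r1 r2 M : (forall z, `|ln (derivative r1 r2 z)| <= M) ->
  moebius_dist r1 r2 <= M.
Proof.
move=> h; apply: ge_sup; first by case: (moebius_dist_has_sup r1 r2).
by move=> _ [z _ <-].
Qed.

Lemma moebius_distxx r : moebius_dist r r = 0.
Proof.
have E : derivative r r = cst 1.
  by apply: moebius_derivativeE; split => // [x|x y];
    [exact: cvg_cst|rewrite !mul1r].
apply/eqP; rewrite eq_le; apply/andP; split.
  by apply: moebius_dist_lub => z; rewrite E ln1 normr0.
have [a _] := Z4.
exact: le_trans (moebius_dist_ub r r a).
Qed.

Lemma moebius_dist_positivity r1 r2 : moebius_dist r1 r2 = 0 -> r1 = r2.
Proof.
move=> d0; have [D0 _ DE] := moebius_derivativeP r1 r2.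
have D1 z : derivative r1 r2 z = 1.
  have := moebius_dist_ub r1 r2 z; rewrite d0 normr_le0 => /eqP l0.
  by apply: ln_inj; rewrite ?posrE// ?ltr01// l0 ln1.
have E : r1 = r2 :> (Z -> Z -> R).
  have [[_ p1 _ _] _ _] := moebius_rho_antipodal r1.
  have [[_ p2 _ _] _ _] := moebius_rho_antipodal r2.
  apply/funext => x; apply/funext => y; apply/eqP.
  by rewrite -(@eqrXn2 _ 2)// DE !D1 !mul1r.
case: r1 r2 E {d0 D0 DE D1} => [f1 a1 e1] [f2 a2 e2] /= E.
by subst f2; congr MoebiusSpace; exact: Prop_irrelevance.
Qed.

Lemma moebius_dist_sym r1 r2 : moebius_dist r1 r2 = moebius_dist r2 r1.
Proof.
have [D0 cD DE] := moebius_derivativeP r1 r2.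
have E : derivative r2 r1 = fun z => (derivative r1 r2 z)^-1.
  apply: moebius_derivativeE; split => [x|x|x y].
  - by rewrite invr_gt0.
  - by apply: cvgV; [rewrite gt_eqF|exact: cD].
  - rewrite DE; have := lt0r_neq0 (D0 x); have := lt0r_neq0 (D0 y).
    by move=> *; field; do ?[apply/andP; split].
rewrite /moebius_dist E; congr sup; apply: eq_imagel => z _ /=.
by rewrite lnV ?posrE// normrN.
Qed.

Lemma moebius_dist_triangle r2 r1 r3 :
  moebius_dist r1 r3 <= moebius_dist r1 r2 + moebius_dist r2 r3.
Proof.
have [D0 cD DE] := moebius_derivativeP r1 r2.
have [D'0 cD' D'E] := moebius_derivativeP r2 r3.
have E : derivative r1 r3 = fun z => derivative r1 r2 z * derivative r2 r3 z.
  apply: moebius_derivativeE; split => [x|x|x y].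
  - by rewrite mulr_gt0.
  - by apply: cvgM; [exact: cD|exact: cD'].
  - by rewrite D'E DE; ring.
apply: moebius_dist_lub => z; rewrite E lnM ?posrE//.
by rewrite (le_trans (ler_normD _ _))// lerD// moebius_dist_ub.
Qed.

HB.instance Definition _ := gen_eqMixin (moebius_space Z).
HB.instance Definition _ := gen_choiceMixin (moebius_space Z).
HB.instance Definition _ := isMetric.Build R (moebius_space Z)
  moebius_distxx moebius_dist_positivity moebius_dist_sym moebius_dist_triangle.

End MoebiusMetric.

Section Geodesics.
Context {R : realType}.
Implicit Type X : metricType R.

Definition proper_metric_space X : Prop :=
  forall (x : X) (r : R), compact [set y : X | mdist x y <= r].

Definition isometric_on X (A : set R) (c : R -> X) : Prop :=
  forall s t, A s -> A t -> mdist (c s) (c t) = `|s - t|.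

Definition geodesic_metric_space X : Prop :=
  forall x y : X, exists c : R -> X,
    [/\ isometric_on `[0, mdist x y] c, c 0 = x & c (mdist x y) = y].

Definition geodesically_complete X : Prop :=
  forall (a b : R) (c : R -> X), a <= b -> isometric_on `[a, b] c ->
    exists c' : R -> X,
      isometric_on setT c' /\ forall t, `[a, b]%classic t -> c' t = c t.

(* (y|z)_x *)
Definition gromov_product X (x y z : X) : R :=
  (mdist x y + mdist x z - mdist y z) / 2.

End Geodesics.

(* The compactification [gps_hat] and the extension [gps_product x] of the
   Gromov product (.|.)_x to it are part of the structure: the former is unique
   up to an equivalence that is the identity on the space, the latter is unique
   by density. *)
Record gromovProductSpace (R : realType) := GromovProductSpace {
  gps_space :> metricType R;
  gps_proper : proper_metric_space gps_space;
  gps_geodesic : geodesic_metric_space gps_space;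
  gps_complete : geodesically_complete gps_space;
  gps_hat : topologicalType;
  gps_hat_compact : compact [set: gps_hat];
  gps_hat_hausdorff : hausdorff_space gps_hat;
  gps_hat_second_countable : @second_countable gps_hat;
  gps_incl : gps_space -> gps_hat;
  gps_incl_embedding : topological_embedding gps_incl;
  gps_incl_dense : dense (range gps_incl);
  gps_product : gps_space -> gps_hat -> gps_hat -> \bar R;
  gps_product_ge0 : forall x y z, (0 <= gps_product x y z)%E;
  gps_product_continuous : forall x,
    continuous (fun p : gps_hat * gps_hat => gps_product x p.1 p.2);
  gps_product_incl : forall x y z,
    gps_product x (gps_incl y) (gps_incl z) = (gromov_product x y z)%:E;
  gps_product_boundary : forall x (xi eta : gps_hat),
    (~` range gps_incl) xi -> (~` range gps_incl) eta ->
    gps_product x xi eta = +oo%E <-> xi = eta }.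

Section Maximal.
Context {R : realType}.
Implicit Types X Y : gromovProductSpace R.

Definition gp_boundary X : topologicalType :=
  set_type (~` range (@gps_incl R X)).

Definition gp_boundary_val X (xi : gp_boundary X) : gps_hat X := set_val xi.

(* rho_x = exp (- (.|.)_x), with exp (- oo) = 0 *)
Definition gp_rho X (x : X) (xi eta : gp_boundary X) : R :=
  fine (expeR (- gps_product x (gp_boundary_val xi) (gp_boundary_val eta))).

(* All the [gp_rho x] are Moebius equivalent, so the choice of base points does
   not matter. *)
Definition moebius_homeomorphism Y X (f : gp_boundary Y -> gp_boundary X) :
    Prop :=
  homeomorphism f /\
  forall (y : Y) (x : X), moebius_map (gp_rho y) (gp_rho x) f.

Definition maximal_gromov_product_space X : Prop :=
  forall Y (f : gp_boundary Y -> gp_boundary X), moebius_homeomorphism f ->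
    exists (F : Y -> X) (Fhat : gps_hat Y -> gps_hat X),
      [/\ forall y y' : Y, mdist (F y) (F y') = mdist y y',
          forall y : Y, Fhat (gps_incl y) = gps_incl (F y),
          forall xi : gp_boundary Y,
            Fhat (gp_boundary_val xi) = gp_boundary_val (f xi)
        & continuous Fhat].

End Maximal.

(* Main.v *)
Require Import Defs.
From HB Require Import structures.
From mathcomp Require Import all_boot all_order all_algebra.
From mathcomp Require Import ring lra.
From mathcomp Require Import all_classical all_reals all_analysis.

Set Implicit Arguments.
Unset Strict Implicit.
Unset Printing Implicit Defensive.

Import Order.TTheory GRing.Theory Num.Theory.
Import numFieldNormedType.Exports.

Local Open Scope classical_set_scope.
Local Open Scope ring_scope.

(** Both conditions on [X] turn out to say that [X] is the tight span of its
    boundary.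

    Let rho be an antipodal function on a compact space Z.  The antipodal
    functions Moebius equivalent to rho are the functions
    exp (- (f x + f y) / 2) * rho x y, where f runs over the bounded solutions of
    f x = sup_y (2 ln (rho x y) - f y), that is of [dual f = f], and the Moebius
    distance is the sup distance between the functions f.  So the Moebius space
    is the tight span of Isbell and Dress (here [tightSpan]) of the generalized
    metric 2 ln rho, whose diagonal is -oo.  The classical argument for
    injectivity applies: the McShane extension of a 1-Lipschitz map takes values
    in functions with f x + f y >= 2 ln (rho x y), and iterating
    f |-> (f + dual f) / 2 retracts these functions onto the extremal ones
    without increasing distances.  This gives [tight_span_injective] and
    [moebius_space_injective].

    For a Gromov product space X with a base point, the Busemann functions of
    the points embed X isometrically in the tight span of its boundary
    ([visual], [visual_isometric]).

    - If X is maximal, this embedding is onto ([maximal_visual_onto]), so X is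
      injective.  Indeed the tight span of the boundary of X is itself a Gromov
      product space with that boundary ([tight_span_gps],
      [ts_end_homeomorphism]).  Maximality sends it isometrically into X,
      compatibly with the boundaries, hence with all Gromov products, and
      therefore a function e goes to a point whose Busemann function is e.

    - If X is injective, the embedding is onto as well
      ([injective_visual_onto]).  There is a 1-Lipschitz map from the tight span
      to X that inverts the embedding.  If it sends e to x, then
      d(x, y) <= d(e, visual y) for all y in X, and letting y tend to a boundary
      point xi gives that the Busemann function of x is at most e at xi.
      Extremal functions are minimal, so the two are equal.  Now let f be a
      Moebius homeomorphism onto the boundary of X from that of Y: it carries
      the Busemann functions of Y to extremal functions on the boundary of X,
      that is to points of X, which is the embedding to be found
      ([moebius_extends]).

    The geometry of the tight span itself rests on contact points: every x has
    some y with f x + f y = 2 ln (rho x y) ([contact]), and the distance of f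
    and g is attained with both signs at a pair which is in contact for f and
    for g ([dist_contact]).  Along such a pair a geodesic can be prolonged
    ([ts_complete]).  A function f of large norm is close, as far as Gromov
    products are concerned, to the point of Z where it is lowest
    ([hdist_high]), and this is what makes the union of the tight span and Z
    compact ([hat_compact]). *)

(** * Extremal functions and the retraction onto them *)

(** The data on which the tight span depends; [ak_rho_le1] and [ak_antipode] say
    that the supremum of [ak_rho] is 1 and is attained from every point. *)
Record antipodalKernel (R : realType) := AntipodalKernel {
  ak_carrier :> topologicalType;
  ak_compact : compact [set: ak_carrier];
  ak_rho : ak_carrier -> ak_carrier -> R;
  ak_separating : separating_function ak_rho;
  ak_rho_le1 : forall x y, ak_rho x y <= 1;
  ak_antipode : forall x, exists y, ak_rho x y = 1;
  ak_point : ak_carrier }.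

Section Retraction.
Context {R : realType} {Z : antipodalKernel R}.
Implicit Types (f g : Z -> R) (x y : Z).

Local Notation rho := (@ak_rho R Z).

Lemma ak_rho_ge0 x y : 0 <= rho x y.
Proof. by have [_ +] := ak_separating Z. Qed.

Lemma ak_rhoC x y : rho x y = rho y x.
Proof. by have [_ _ + _] := ak_separating Z. Qed.

Lemma ak_rho_eq0 x y : rho x y = 0 <-> x = y.
Proof. by have [_ _ _ +] := ak_separating Z. Qed.

Lemma ak_rhoxx x : rho x x = 0.
Proof. exact/ak_rho_eq0. Qed.

Definition sup_bounded f := exists M, forall x, `|f x| <= M.

(** f x + f y >= 2 ln (rho x y), written with the exponential so that it is
    also correct on the diagonal, where rho vanishes. *)
Definition admissible f :=
  forall x y, rho x y <= expR ((f x + f y) / 2).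

(** sup_y (2 ln (rho x y) - f y).  The supremum is inside the logarithm because
    [ln 0 = 0]: otherwise y = x would contribute - f x instead of -oo. *)
Definition dual f x := 2 * ln (sup (range (fun y => rho x y * expR (- f y / 2)))).

Lemma dual_has_sup f x : sup_bounded f ->
  has_sup (range (fun y => rho x y * expR (- f y / 2))).
Proof.
move=> [M fM]; split.
  by have [y _] := ak_antipode x; exists (rho x y * expR (- f y / 2)), y.
exists (expR (M / 2)) => _ [y _ <-].
apply: (le_trans (y := 1 * expR (- f y / 2))).
  by rewrite ler_wpM2r ?expR_ge0// ak_rho_le1.
by rewrite mul1r ler_expR; have := fM y; rewrite ler_norml; lra.
Qed.

(** The universal property of the supremum, from which everything else about
    [dual] is derived. *)
Lemma dual_leP f x c : sup_bounded f ->
  dual f x <= c <-> forall y, rho x y <= expR ((c + f y) / 2).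
Proof.
move=> bf; have hs := dual_has_sup x bf; rewrite /dual.
set S := sup _.
have S0 : 0 < S.
  have [y xy] := ak_antipode x.
  apply: (lt_le_trans (expR_gt0 (- f y / 2))).
  by apply: (ub_le_sup hs.2); exists y => //; rewrite xy mul1r.
have -> : (2 * ln S <= c) = (S <= expR (c / 2)).
  by rewrite -{2}(lnK S0) ler_expR; apply/idP/idP => ?; lra.
have E y : (rho x y <= expR ((c + f y) / 2)) =
           (rho x y * expR (- f y / 2) <= expR (c / 2)).
  rewrite mulrDl expRD mulNr expRN.
  by rewrite ler_pdivrMr// expR_gt0.
split=> [Sc y|h].
  by rewrite E; apply: le_trans Sc; apply: (ub_le_sup hs.2); exists y.
by apply: (ge_sup hs.1) => _ [y _ <-]; rewrite -E.
Qed.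

Lemma dual_rho f x y : sup_bounded f -> rho x y <= expR ((dual f x + f y) / 2).
Proof. by move=> bf; exact: (dual_leP x (dual f x) bf).1. Qed.

Lemma admissibleP f : sup_bounded f ->
  admissible f <-> forall x, dual f x <= f x.
Proof.
by move=> bf; split=> h x; [apply/dual_leP|apply: (dual_leP x (f x) bf).1].
Qed.

(** The upper bound comes from rho <= 1, the lower one from a point y with
    rho x y = 1, which contributes - f y. *)
Lemma dual_bound f M : (forall x, `|f x| <= M) -> forall x, `|dual f x| <= M.
Proof.
move=> fM x; have bf : sup_bounded f by exists M.
rewrite ler_norml; apply/andP; split.
  have [y xy] := ak_antipode x; have := dual_rho x y bf.
  rewrite xy -[leLHS]expR0 ler_expR; have := fM y; rewrite ler_norml; lra.
apply/dual_leP => // y; apply: (le_trans (ak_rho_le1 x y)).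
by rewrite -[leLHS]expR0 ler_expR; have := fM y; rewrite ler_norml; lra.
Qed.

Lemma dual_le_shift f g d : sup_bounded f -> sup_bounded g ->
  (forall x, f x <= g x + d) -> forall x, dual g x <= dual f x + d.
Proof.
move=> bf bg fg x; apply/dual_leP => // y.
by rewrite (le_trans (dual_rho x y bf))// ler_expR; have := fg y; lra.
Qed.

Definition average f x := (f x + dual f x) / 2.

Definition admissible_le M f := (forall x, `|f x| <= M) /\ admissible f.

Lemma admissible_le_bounded M f : admissible_le M f -> sup_bounded f.
Proof. by case=> fM _; exists M. Qed.

Lemma average_le M f x : admissible_le M f -> average f x <= f x.
Proof.
move=> gf; have bf := admissible_le_bounded gf; have [fM af] := gf.
by rewrite /average; have := (admissibleP bf).1 af x; lra.
Qed.

Lemma admissible_le_average M f : admissible_le M f -> admissible_le M (average f).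
Proof.
move=> gf; have bf := admissible_le_bounded gf; have [fM af] := gf.
split=> [x|x y].
  have := fM x; have := dual_bound fM x; rewrite /average !ler_norml; lra.
have xy := dual_rho x y bf; have := dual_rho y x bf; rewrite ak_rhoC => yx.
rewrite /average; have [h|h] := leP (dual f x + f y) (dual f y + f x).
  by rewrite (le_trans xy)// ler_expR; lra.
by rewrite (le_trans yx)// ler_expR; lra.
Qed.

(** As [dual] reverses the order and [average f <= f], the dual does not
    decrease under averaging; so one step halves the distance from f to its
    dual. *)
Lemma average_gap M f : admissible_le M f ->
  forall x, average f x - dual (average f) x <= (f x - dual f x) / 2.
Proof.
move=> gf x; have : dual f x <= dual (average f) x + 0.
  apply: dual_le_shift (admissible_le_bounded gf) _ _.
    exact: admissible_le_bounded (admissible_le_average gf).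
  by move=> y; rewrite addr0 (average_le _ gf).
by rewrite /average; lra.
Qed.

Lemma admissible_le_iter M f n : admissible_le M f -> admissible_le M (iter n average f).
Proof. by move=> gf; elim: n => // n; exact: admissible_le_average. Qed.

Lemma iter_average_gap M f n x : admissible_le M f ->
  iter n average f x - dual (iter n average f) x <= 2 * M / 2 ^+ n.
Proof.
move=> gf; elim: n => [|n ih].
  rewrite expr0 divr1 /=; have [fM _] := gf.
  by have := fM x; have := dual_bound fM x; rewrite !ler_norml; lra.
rewrite iterS (le_trans (average_gap (admissible_le_iter n gf) x))//.
by rewrite exprSr invfM mulrA ler_pM2r// invr_gt0.
Qed.

Lemma iter_average_anti M f m n x : admissible_le M f -> (m <= n)%N ->
  iter n average f x <= iter m average f x.
Proof.
move=> gf /subnK <-; elim: (n - m)%N => // k.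
by apply: le_trans; exact: (average_le _ (admissible_le_iter (k + m) gf)).
Qed.

Lemma average_lip M f g d : admissible_le M f -> admissible_le M g ->
  (forall x, `|f x - g x| <= d) -> forall x, `|average f x - average g x| <= d.
Proof.
move=> gf gg fg x; have bf := admissible_le_bounded gf; have bg := admissible_le_bounded gg.
have h1 : dual g x <= dual f x + d.
  by apply: dual_le_shift => // y; have := fg y; rewrite ler_norml; lra.
have h2 : dual f x <= dual g x + d.
  by apply: dual_le_shift => // y; have := fg y; rewrite ler_norml; lra.
by have := fg x; rewrite /average !ler_norml; lra.
Qed.

Lemma iter_average_lip M f g d n : admissible_le M f -> admissible_le M g ->
  (forall x, `|f x - g x| <= d) ->
  forall x, `|iter n average f x - iter n average g x| <= d.
Proof.
move=> gf gg fg; elim: n => // n ih x.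
by rewrite !iterS; apply: (average_lip (admissible_le_iter n gf) (admissible_le_iter n gg)).
Qed.

(** The iterates of [average] decrease, so the infimum is their limit. *)
Definition retract f x := inf (range (fun n => iter n average f x)).

Lemma retract_has_lbound M f x : admissible_le M f ->
  has_lbound (range (fun n => iter n average f x)).
Proof.
move=> gf; exists (- M) => _ [n _ <-].
by have [/(_ x) + _] := admissible_le_iter n gf; rewrite ler_norml => /andP[].
Qed.

Lemma retract_le_iter M f n x : admissible_le M f -> retract f x <= iter n average f x.
Proof.
by move=> gf; apply: ge_inf; [exact: (retract_has_lbound _ gf)|exists n].
Qed.

Lemma retract_le M f x : admissible_le M f -> retract f x <= f x.
Proof. exact: (retract_le_iter 0). Qed.

Lemma le_retract c f x : (forall n, c <= iter n average f x) -> c <= retract f x.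
Proof.
move=> h; apply: lb_le_inf => [|_ [n _ <-]]; last exact: h.
by exists (f x), 0.
Qed.

Lemma retract_bound M f : admissible_le M f -> forall x, `|retract f x| <= M.
Proof.
move=> gf x; rewrite ler_norml; apply/andP; split.
  apply: le_retract => n.
  by have [/(_ x) + _] := admissible_le_iter n gf; rewrite ler_norml => /andP[].
rewrite (le_trans (retract_le x gf))//.
by have [/(_ x) + _] := gf; rewrite ler_norml => /andP[].
Qed.

(** Any two iterates m, n dominate the iterate max m n, which is admissible;
    taking the infimum in m and n separately shows that the limit is admissible.
    Conversely the gap between the n-th iterate and its dual is O(2^-n). *)
Lemma retract_extremal M f x : admissible_le M f -> dual (retract f) x = retract f x.
Proof.
move=> gf; have br : sup_bounded (retract f) by exists M; exact: retract_bound.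
apply/eqP; rewrite eq_le; apply/andP; split.
  apply: le_retract => n; apply/dual_leP => // y.
  have bn := admissible_le_bounded (admissible_le_iter n gf).
  suff /dual_leP : dual (iter n average f) y <= retract f y.
    by move=> /(_ bn x); rewrite ak_rhoC addrC.
  apply: le_retract => m; apply/dual_leP => // z.
  have [_ /(_ y z)] := admissible_le_iter (maxn n m) gf.
  move=> /le_trans; apply; rewrite ler_expR ler_pM2r//.
  by rewrite lerD// (iter_average_anti _ gf)// ?leq_maxl ?leq_maxr.
apply/ler_addgt0Pl => e e0.
have [n ne] : exists n, 2 * M / 2 ^+ n <= e.
  have : (fun n => 2 * M * 2^-1 ^+ n) @ \oo --> 2 * M * 0.
    apply: cvgMr; apply: cvg_expr; rewrite ger0_norm; lra.
  rewrite mulr0 => /cvgrPdist_le /(_ _ e0) [n _ /(_ n (leqnn n))].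
  rewrite sub0r normrN exprVn => h; exists n.
  exact: le_trans (ler_norm _) h.
have h1 := retract_le_iter n x gf; have h2 := iter_average_gap n x gf.
have h3 : dual (iter n average f) x <= dual (retract f) x + 0.
  apply: (dual_le_shift br (admissible_le_bounded (admissible_le_iter n gf))) => y.
  by rewrite addr0 (retract_le_iter _ _ gf).
by rewrite addrC; move: h1 h2 h3 ne; set u := _ / _; lra.
Qed.

Lemma retract_id f : (forall x, dual f x = f x) -> retract f = f.
Proof.
move=> ef; have av : average f = f.
  by apply/funext => x; rewrite /average ef; lra.
have it n : iter n average f = f by elim: n => // n; rewrite iterS => ->.
apply/funext => x; rewrite /retract.
have -> : range (fun n => iter n average f x) = [set f x].
  apply/seteqP; split=> [_ [n _ <-]|_ ->]; first by rewrite it.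
  by exists 0.
exact: inf1.
Qed.

(** [average] does not increase sup distances, because [dual] does not. *)
Lemma retract_lip M f g d : admissible_le M f -> admissible_le M g ->
  (forall x, `|f x - g x| <= d) -> forall x, `|retract f x - retract g x| <= d.
Proof.
move=> gf gg fg x.
suff h f' g' : admissible_le M f' -> admissible_le M g' ->
    (forall x, `|f' x - g' x| <= d) ->
    retract f' x - d <= retract g' x.
  have h1 := h _ _ gf gg fg; have := h _ _ gg gf.
  rewrite ler_norml => /(_ _)/le_trans h2; apply/andP; split; last by lra.
  suff: retract g x - d <= retract f x by lra.
  by apply: h2 => // y; rewrite distrC.
move=> gf' gg' fg'; apply: le_retract => n.
have := iter_average_lip n gf' gg' fg' x; have := retract_le_iter n x gf'.
by rewrite ler_norml; lra.
Qed.

End Retraction.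

(** * The tight span and its injectivity *)

Record tightSpan (R : realType) (Z : antipodalKernel R) := TightSpan {
  ts_fun :> Z -> R;
  ts_bounded : sup_bounded ts_fun;
  ts_dual : forall x, dual ts_fun x = ts_fun x }.

Section Metric.
Context {R : realType} {Z : antipodalKernel R}.
Implicit Types (f g h : tightSpan Z) (x y : Z).

Local Notation rho := (@ak_rho R Z).

Lemma ts_eq f g : (forall x, f x = g x) -> f = g.
Proof.
case: f g => [f bf df] [g bg dg] /= /funext fg; subst g.
by congr TightSpan; exact: Prop_irrelevance.
Qed.

Definition ts_dist f g := sup (range (fun x => `|f x - g x|)).

Lemma ts_dist_has_sup f g : has_sup (range (fun x => `|f x - g x|)).
Proof.
split; first by exists `|f (ak_point Z) - g (ak_point Z)|, (ak_point Z).
have [M fM] := ts_bounded f; have [N gN] := ts_bounded g.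
exists (M + N) => _ [x _ <-].
by rewrite (le_trans (ler_normB _ _))// lerD.
Qed.

Lemma ts_dist_ub f g x : `|f x - g x| <= ts_dist f g.
Proof. by apply: (ub_le_sup (ts_dist_has_sup f g).2); exists x. Qed.

Lemma ts_dist_lub f g d : (forall x, `|f x - g x| <= d) -> ts_dist f g <= d.
Proof.
by move=> fg; apply: (ge_sup (ts_dist_has_sup f g).1) => _ [x _ <-].
Qed.

Lemma ts_distxx f : ts_dist f f = 0.
Proof.
apply/eqP; rewrite eq_le; apply/andP; split.
  by apply: ts_dist_lub => x; rewrite subrr normr0.
exact: le_trans (ts_dist_ub f f (ak_point Z)).
Qed.

Lemma ts_dist_positivity f g : ts_dist f g = 0 -> f = g.
Proof.
move=> fg; apply: ts_eq => x; apply/eqP; rewrite -subr_eq0 -normr_le0 -fg.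
exact: ts_dist_ub.
Qed.

Lemma ts_dist_sym f g : ts_dist f g = ts_dist g f.
Proof.
by rewrite /ts_dist; congr sup; apply: eq_imagel => x _; exact: distrC.
Qed.

Lemma ts_dist_triangle g f h : ts_dist f h <= ts_dist f g + ts_dist g h.
Proof.
apply: ts_dist_lub => x; rewrite -(subrKA (g x)).
by rewrite (le_trans (ler_normD _ _))// lerD// ts_dist_ub.
Qed.

HB.instance Definition _ := gen_eqMixin (tightSpan Z).
HB.instance Definition _ := gen_choiceMixin (tightSpan Z).
HB.instance Definition _ := isMetric.Build R (tightSpan Z)
  ts_distxx ts_dist_positivity ts_dist_sym ts_dist_triangle.

Lemma ts_ub f g x : `|f x - g x| <= mdist f g.
Proof. exact: ts_dist_ub. Qed.

Lemma ts_le f g x : f x <= g x + mdist f g.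
Proof. by have := ts_ub f g x; rewrite ler_norml; lra. Qed.

Lemma ts_lub f g d : (forall x, `|f x - g x| <= d) -> mdist f g <= d.
Proof. exact: ts_dist_lub. Qed.

Lemma ts_rho f x y : rho x y <= expR ((f x + f y) / 2).
Proof. by have := dual_rho x y (ts_bounded f); rewrite ts_dual. Qed.

Lemma ts_admissible f : admissible f.
Proof. by move=> x y; exact: ts_rho. Qed.

Lemma ts_admissible_le f : exists M, admissible_le M f.
Proof. by have [M fM] := ts_bounded f; exists M; split=> //; exact: ts_admissible. Qed.

Lemma admissible_le_zero : admissible_le 0 (fun _ : Z => 0 : R).
Proof.
by split=> [x|x y]; rewrite ?normr0// addr0 mul0r expR0 ak_rho_le1.
Qed.

Lemma dual_zero x : dual (fun _ : Z => 0 : R) x = 0.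
Proof.
apply/eqP; have := dual_bound admissible_le_zero.1 x.
by rewrite normr_le0.
Qed.

(** It corresponds to the antipodal function rho itself and serves as the base
    point. *)
Definition ts_zero : tightSpan Z :=
  TightSpan (ex_intro _ 0 admissible_le_zero.1) dual_zero.

Definition ts_retract M (u : Z -> R) (gu : admissible_le M u) : tightSpan Z :=
  TightSpan (ex_intro _ M (retract_bound gu)) (fun x => retract_extremal x gu).

Lemma ts_retract_lip M N (u v : Z -> R) (gu : admissible_le M u)
    (gv : admissible_le N v) d :
  (forall x, `|u x - v x| <= d) -> mdist (ts_retract gu) (ts_retract gv) <= d.
Proof.
move=> uv; apply: ts_lub => x /=.
have gu' : admissible_le (Num.max M N) u.
  by case: gu => uM au; split=> // y; rewrite (le_trans (uM y))// le_max lexx.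
have gv' : admissible_le (Num.max M N) v.
  by case: gv => vN av; split=> // y; rewrite (le_trans (vN y))// le_max lexx orbT.
exact: (retract_lip gu' gv').
Qed.

(** Points of the tight span are functions, and H b x = inf_a (F a x + d(b, a))
    is the largest 1-Lipschitz extension of a |-> F a x for each x separately.
    It is admissible as a function of x, since F a x + F a' y + d(a, b) + d(b, a')
    >= F a x + F a y.  The retraction makes it extremal and leaves it
    unchanged for b in A. *)
Lemma tight_span_injective : injective_metric_space (tightSpan Z).
Proof.
move=> B A F Flip.
have [[a0 _]|noA] := pselect (exists a : set_type A, True); last first.
  exists (fun _ => ts_zero); split=> [x y|a]; first by rewrite mdistxx mdist_ge0.
  by case: noA; exists a.
pose S b x := [set F a x + mdist b (set_val a) | a in [set: set_type A]].
pose H b x := inf (S b x).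
have S0 b x : S b x !=set0 by exists (F a0 x + mdist b (set_val a0)), a0.
have lb b x a : F a0 x - mdist b (set_val a0) <= F a x + mdist b (set_val a).
  have := ts_le (F a0) (F a) x; have := Flip a0 a.
  have := metric_triangle (set_val a0) b (set_val a).
  rewrite (metric_sym (set_val a0) b).
  by move=> h1 h2 h3; move: h1 h2 h3; rewrite /=; lra.
have hlb b x : has_lbound (S b x).
  by exists (F a0 x - mdist b (set_val a0)) => _ [a _ <-].
have Hle b x a : H b x <= F a x + mdist b (set_val a).
  by apply: (ge_inf (hlb b x)); exists a.
have leH b x c : (forall a, c <= F a x + mdist b (set_val a)) -> c <= H b x.
  by move=> h; apply: (lb_le_inf (S0 b x)) => _ [a _ <-].
have Hlip b b' x : H b x <= H b' x + mdist b b'.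
  suff : H b x - mdist b b' <= H b' x by lra.
  apply: (leH) => a; have := Hle b x a.
  by have := metric_triangle b b' (set_val a); lra.
have [M0 gF0] := ts_admissible_le (F a0).
have gH b : admissible_le (M0 + mdist b (set_val a0)) (H b).
  split=> [x|x y].
    have := Hle b x a0; have := leH b x _ (lb b x).
    by have := gF0.1 x; rewrite !ler_norml; lra.
  have [->|xy] := eqVneq x y; first by rewrite ak_rhoxx expR_ge0.
  have r0 : 0 < rho x y.
    rewrite lt_neqAle ak_rho_ge0 andbT eq_sym; apply/eqP => /ak_rho_eq0/eqP.
    by rewrite (negbTE xy).
  rewrite -(lnK (r0 : rho x y \is Num.pos)) ler_expR.
  suff : 2 * ln (rho x y) - H b y <= H b x by lra.
  apply: (leH) => a.
  suff : 2 * ln (rho x y) - (F a x + mdist b (set_val a)) <= H b y by lra.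
  apply: (leH) => a'.
  have := ts_rho (F a) x y; rewrite -{1}(lnK (r0 : rho x y \is Num.pos)) ler_expR.
  have := ts_le (F a) (F a') y; have := Flip a a'.
  have := metric_triangle (set_val a) b (set_val a').
  by rewrite (metric_sym (set_val a) b) /=; lra.
exists (fun b => ts_retract (gH b)); split=> [b b'|a].
  apply: ts_retract_lip => x; rewrite ler_norml.
  by have := Hlip b b' x; have := Hlip b' b x; rewrite (metric_sym b'); lra.
apply: ts_eq => x /=.
have -> : H (set_val a) = F a.
  apply/funext => z; apply/eqP; rewrite eq_le; apply/andP; split.
    by have := Hle (set_val a) z a; rewrite mdistxx addr0.
  apply: leH => a'; have := ts_le (F a) (F a') z; have := Flip a a'.
  by rewrite /=; lra.
by rewrite retract_id// => z; exact: ts_dual.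
Qed.

End Metric.

(** * Continuity of extremal functions, contact points *)

Lemma le_2ln (R : realType) (a c : R) : 0 < c ->
  (a <= 2 * ln c) = (expR (a / 2) <= c).
Proof.
by move=> c0; rewrite -{2}(lnK (c0 : c \is Num.pos)) ler_expR; apply/idP/idP; lra.
Qed.

Section Contact.
Context {R : realType} {Z : antipodalKernel R}.
Implicit Types (f g h : tightSpan Z) (x y z : Z) (e d : R).

Local Notation rho := (@ak_rho R Z).

Lemma ak_rho_continuous : continuous (fun p : Z * Z => rho p.1 p.2).
Proof. by have [] := ak_separating Z. Qed.

Lemma ak_rho_continuous1 x : continuous (rho x).
Proof.
move=> y; apply: (@continuous_comp _ _ _ (fun y => (x, y)) (fun q => rho q.1 q.2)).
  by apply: cvg_pair => //=; exact: cvg_cst.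
exact: ak_rho_continuous.
Qed.

(** Compactness turns continuity of rho into uniformity in y. *)
Lemma rho_near_unif e x : 0 < e ->
  \forall x' \near x, forall y, `|rho x y - rho x' y| <= e.
Proof.
move=> e0; have /compact_near_coveringP nc := @ak_compact R Z.
suff : \forall x' \near x, [set: Z] `<=` (fun y => `|rho x y - rho x' y| <= e).
  by apply: filterS => x' + y; exact.
apply: nc => y _.
have c1 := @ak_rho_continuous (x, y).
have /cvgrPdist_le/(_ (e / 2)) := c1.
rewrite divr_gt0// => /(_ isT) [[U V]] /= [Ux Vy] UV.
exists (V, U) => //= -[y' x'] /= [Vy' Ux'].
have h1 := UV (x', y') (conj Ux' Vy').
have h2 := UV (x, y') (conj (nbhs_singleton Ux) Vy').
move: h1 h2 => /=; rewrite !ler_norml; lra.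
Qed.

(** By compactness, points at which rho is small are close to each other,
    because rho vanishes only on the diagonal; so rho, which satisfies no triangle
    inequality, still controls the differences of the functions rho x and rho y. *)
Lemma rho_close_diag e : 0 < e ->
  exists2 d, 0 < d & forall x y, rho x y <= d ->
    forall z, `|rho x z - rho y z| <= e.
Proof.
move=> e0; have /compact_near_coveringP nc := @ak_compact R Z.
have e20 : 0 < e / 2 by rewrite divr_gt0.
have key : forall x, [set: Z] x -> \forall x' \near x & d \near (0:R)^'+,
    forall y, rho x' y <= d -> forall z, `|rho x' z - rho y z| <= e.
  move=> x _.
  have nearxy : \forall t \near filter_prod (nbhs x) (0:R)^'+, [set: Z] `<=`
      (fun y => rho t.1 y <= t.2 -> forall z, `|rho t.1 z - rho y z| <= e).
    apply: nc => y _; have [->|xy] := eqVneq x y.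
      have U := rho_near_unif y e20.
      exists ([set y' | forall z, `|rho y z - rho y' z| <= e / 2],
        [set t | forall z, `|rho y z - rho t.1 z| <= e / 2]) => /=.
        split => //.
        exists ([set x' | forall z, `|rho y z - rho x' z| <= e / 2], setT) => /=.
          by split=> //; exact: filterT.
        by move=> [? ?] /= [].
      move=> [y' [x' d]] /= [h1 h2] _ z.
      by have := h1 z; have := h2 z; rewrite !ler_norml; lra.
    have r0 : 0 < rho x y.
      rewrite lt_neqAle ak_rho_ge0 andbT eq_sym; apply/eqP => /ak_rho_eq0/eqP.
      by rewrite (negbTE xy).
    have /cvgrPdist_lt/(_ (rho x y / 2)) := @ak_rho_continuous (x, y).
    rewrite divr_gt0// => /(_ isT) [[U V]] /= [Ux Vy] UV.
    exists (V, [set t | U t.1 /\ t.2 < rho x y / 2]) => /=.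
      split => //; exists (U, [set d | d < rho x y / 2]) => //=.
      split => //; apply: nbhs_right_lt; rewrite divr_gt0//.
    move=> [y' [x' d]] /= [Vy' [Ux' dr]] x'y'.
    have := UV (x', y') (conj Ux' Vy') => /=.
    rewrite ltr_norml; lra.
  case: nearxy => -[U V] /= [Ux V0] UV; exists (U, V) => // -[x' d] /= UVxd y.
  exact: (UV (x', d) UVxd).
have /= [d [d0 hd]] : exists d, 0 < d /\
    [set: Z] `<=` (fun x => forall y, rho x y <= d ->
      forall z, `|rho x z - rho y z| <= e).
  have h := nc _ ((0:R)^'+) _ _ key.
  near (0:R)^'+ => d; exists d; split; first by near: d; exact: nbhs_right_gt.
  by near: d; exact: h.
by exists d => // x y; exact: hd.
Unshelve. all: by end_near. Qed.

Definition height f := mdist f (ts_zero : tightSpan Z).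

Lemma height_ub f x : `|f x| <= height f.
Proof. by have := ts_ub f ts_zero x; rewrite /= subr0. Qed.

(** With the zero function as base point, this is exp (- (f|x)), the Gromov
    product of f with the boundary point x: the distance from f to x is f x, up to
    normalization. *)
Definition horo f x := expR ((f x - height f) / 2).

Lemma horo_gt0 f x : 0 < horo f x. Proof. exact: expR_gt0. Qed.

Lemma horo_le1 f x : horo f x <= 1.
Proof.
by rewrite expR_le1; have := height_ub f x; rewrite ler_norml; lra.
Qed.

(** Since f = dual f, the function [horo f] is a supremum of functions c * rho y
    with 0 <= c <= 1, so it varies no faster than these do. *)
Lemma horo_lip f x x' e : (forall y, `|rho x y - rho x' y| <= e) ->
  horo f x <= horo f x' + e.
Proof.
move=> xx'; have e0 : 0 <= e by exact: le_trans (xx' x).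
set h := height f.
have c0 : 0 < expR (f x' / 2) + e * expR (h / 2).
  by rewrite ltr_pwDl ?expR_gt0// mulr_ge0 ?expR_ge0.
have : dual f x <= 2 * ln (expR (f x' / 2) + e * expR (h / 2)).
  apply/(dual_leP _ _ (ts_bounded f)) => y.
  rewrite mulrDl [2 * _]mulrC mulfK// expRD lnK//.
  have := ts_rho f x' y; rewrite mulrDl expRD => r1.
  have r2 : 1 <= expR (h / 2) * expR (f y / 2).
    rewrite -expRD -[leLHS]expR0 ler_expR; have := height_ub f y.
    by rewrite ler_norml -/h; lra.
  have r3 : rho x y <= rho x' y + e by have := xx' y; rewrite ler_norml; lra.
  apply: (le_trans r3); rewrite mulrDl lerD// -mulrA.
  by rewrite ler_peMr.
rewrite ts_dual le_2ln// /horo !mulrDl !expRD -/h => le1.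
have E : expR (h / 2) * expR (- h / 2) = 1 by rewrite -expRD -mulrDl subrr mul0r expR0.
have -> : e = e * expR (h / 2) * expR (- h / 2) by rewrite -mulrA E mulr1.
by rewrite -mulrDl ler_pM2r ?expR_gt0.
Qed.

Lemma horoE f x : f x = height f + 2 * ln (horo f x).
Proof. by rewrite /horo expRK; lra. Qed.

Lemma horo_continuous f : continuous (horo f).
Proof.
move=> x; apply/cvgrPdist_le => e e0; apply: filterS (rho_near_unif x e0) => x' h.
have h1 := horo_lip f h.
have : horo f x' <= horo f x + e by apply: horo_lip => y; rewrite distrC.
by rewrite ler_norml; lra.
Qed.

Lemma ts_continuous f : continuous f.
Proof.
move=> x; have -> : (f : Z -> R) = fun x => height f + 2 * ln (horo f x).
  by apply/funext => y; exact: horoE.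
apply: cvgD; first exact: cvg_cst.
apply: cvgM; first exact: cvg_cst.
apply: continuous_comp; first exact: horo_continuous.
exact/continuous_ln/horo_gt0.
Qed.

(** The supremum that defines [dual f x = f x] is attained, by compactness and by
    continuity of f. *)
Lemma contact f x : exists y, rho x y = expR ((f x + f y) / 2).
Proof.
pose F y := rho x y * expR (- f y / 2).
have cF : continuous F.
  move=> y; apply: cvgM; first exact: ak_rho_continuous1.
  apply: continuous_comp; last exact: continuous_expR.
  by apply: cvgM; [apply: cvgN; exact: ts_continuous|exact: cvg_cst].
have [y _ ymax] := compact_EVT_max (ex_intro _ (ak_point Z) I) (@ak_compact R Z)
  (continuous_subspaceT cF).
exists y; apply/eqP; rewrite eq_le ts_rho /=.
have Fy0 : 0 < F y.
  have [z xz] := ak_antipode x.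
  apply: lt_le_trans (ymax z (mem_set I)).
  by rewrite /F xz mul1r expR_gt0.
have : dual f x <= 2 * ln (F y).
  apply/(dual_leP _ _ (ts_bounded f)) => z.
  rewrite mulrDl [2 * _]mulrC mulfK// expRD lnK//.
  have := ymax z (mem_set I); rewrite {1}/F mulNr expRN.
  by rewrite ler_pdivrMr ?expR_gt0.
rewrite ts_dual le_2ln// => h.
by move: h; rewrite /F mulNr expRN ler_pdivlMr ?expR_gt0// -expRD -mulrDl.
Qed.

(** Let |f - g| be maximal at x, with f x > g x say, and let y be in contact with
    x for f.  As g is admissible, g y - f y >= f x - g x, so that the maximum is
    attained at y with the other sign, and x, y are in contact for g. *)
Lemma dist_contact f g : exists x y,
  [/\ f x - g x = mdist f g, f y - g y = - mdist f g,
      rho x y = expR ((f x + f y) / 2) & rho x y = expR ((g x + g y) / 2)].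
Proof.
have cfg : continuous (fun x => `|f x - g x|).
  by move=> x; apply: cvg_norm; apply: cvgB; exact: ts_continuous.
have [x _ xmax] := compact_EVT_max (ex_intro _ (ak_point Z) I) (@ak_compact R Z)
  (continuous_subspaceT cfg).
have E : mdist f g = `|f x - g x|.
  apply/eqP; rewrite eq_le ts_ub andbT; apply: ts_lub => y.
  by apply: xmax; exact: mem_set.
have H f' g' : mdist f' g' = f' x - g' x -> exists y,
  [/\ f' y - g' y = - mdist f' g', rho x y = expR ((f' x + f' y) / 2)
    & rho x y = expR ((g' x + g' y) / 2)].
  move=> E'; have [y xy] := contact f' x; exists y.
  have := ts_rho g' x y; rewrite {1}xy ler_expR => h.
  have := ts_ub f' g' y; rewrite ler_norml => /andP[h1 h2].
  have E2 : f' y - g' y = - mdist f' g'.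
    by apply/eqP; rewrite eq_le h1 andbT; lra.
  by split=> //; rewrite xy; congr expR; lra.
have [h|h] := ler0P (f x - g x).
  have E' : mdist g f = g x - f x by rewrite metric_sym E ler0_norm//; lra.
  have [y [h1 h2 h3]] := H _ _ E'.
  exists y, x; rewrite (ak_rhoC y x) h2; split => //.
  - by rewrite metric_sym; lra.
  - by rewrite metric_sym E'; lra.
  - by rewrite -h2 h3 addrC.
  - by rewrite addrC.
have E' : mdist f g = f x - g x by rewrite E gtr0_norm//; lra.
by have [y [h1 h2 h3]] := H _ _ E'; exists x, y; split.
Qed.

End Contact.


(** * Geodesics and compact balls in the tight span *)

(** Extend the isometry of the pair {0, d} onto {x, y} to the real line.  A
    1-Lipschitz map that preserves the distance of 0 and d is isometric between
    them. *)
Lemma injective_geodesic (R : realType) (W : metricType R) :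
  injective_metric_space W -> geodesic_metric_space W.
Proof.
move=> injW x y; set d := mdist x y.
pose A : set R^o := [set 0; d].
pose F (a : set_type A) := if set_val a == 0 then x else y.
have [|c [clip cF]] := injW R^o A F.
  move=> [a /= aA] [b /= bA].
  suff : mdist (F (exist _ a aA)) (F (exist _ b bA)) <= `|b - a| by [].
  rewrite /F !set_valE /=.
  move: aA bA => /set_mem aA /set_mem bA.
  case: eqP aA bA => [-> _|a0 [//|->]]; case: eqP => [-> _|b0 [//|->]].
  - by rewrite mdistxx.
  - by rewrite subr0 ler_norm.
  - by rewrite metric_sym sub0r normrN ler_norm.
  - by rewrite mdistxx.
have c0 : c 0 = x.
  have A0 : (0 : R^o) \in A by apply/mem_set; left.
  by rewrite (cF (exist _ (0 : R^o) A0)) /F set_valE /= eqxx.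
have cd : c d = y.
  have Ad : (d : R^o) \in A by apply/mem_set; right.
  rewrite (cF (exist _ (d : R^o) Ad)) /F set_valE /=; case: eqP => // d0.
  exact: mdist_positivity.
exists c; split=> //.
suff key s t : 0 <= s -> s <= t -> t <= d -> mdist (c s) (c t) = t - s.
  move=> s t; rewrite /= !in_itv /= => /andP[s0 sd] /andP[t0 td].
  have [st|/ltW ts] := leP s t; first by rewrite key// ler0_norm; lra.
  by rewrite metric_sym key// ger0_norm; lra.
move=> s0 st td; have lip u v : mdist (c u) (c v) <= `|v - u| := clip u v.
apply/eqP; rewrite eq_le; apply/andP; split.
  by rewrite (le_trans (lip s t))// ger0_norm//; lra.
have := metric_triangle (c 0) (c s) (c d).
have := metric_triangle (c s) (c t) (c d).
have := lip 0 s; have := lip t d; rewrite subr0 !ger0_norm ?subr_ge0//.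
by rewrite c0 cd -/d; lra.
Qed.

Lemma fmap_ultra (T U : Type) (h : T -> U) (F : set_system T) :
  UltraFilter F -> UltraFilter (h x @[x --> F]).
Proof.
move=> UF; have PF := ultra_proper; split; first exact: fmap_proper_filter.
move=> G PG sG; apply/seteqP; split=> // A GA.
have [//|nA] := in_ultra_setVsetC (h @^-1` A) UF.
have GnA : G (~` A) by apply: sG.
by have [z []] := filter_ex (filterI GA GnA).
Qed.

Lemma ultra_compact_cvg (T : Type) (V : topologicalType) (K : set V)
    (F : set_system T) (h : T -> V) : compact K -> UltraFilter F ->
  F (h @^-1` K) -> exists2 v, K v & h x @[x --> F] --> v.
Proof.
rewrite compact_ultra => cK UF FK.
by have [v [Kv hv]] := cK _ (fmap_ultra h UF) FK; exists v.
Qed.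

Section Geometry.
Context {R : realType} {Z : antipodalKernel R}.
Implicit Types (f g h : tightSpan Z) (x y z : Z) (e d : R).

Local Notation rho := (@ak_rho R Z).

(** f is [height f] + 2 ln (horo f), and [horo f] is bounded below on a ball, so
    equicontinuity follows from [horo_lip]. *)
Lemma ts_equicontinuous M x e : 0 < e -> \forall x' \near x,
  forall f, height f <= M -> `|f x - f x'| <= e.
Proof.
move=> e0.
(* the exponential compensates the lower bound exp (- M) of horo f on the ball *)
pose d := e / 2 * expR (- M).
have d0 : 0 < d by rewrite mulr_gt0 ?expR_gt0// divr_gt0.
apply: filterS (rho_near_unif x d0) => x' h f fM.
suff key u v : (forall y, `|rho u y - rho v y| <= d) -> f u <= f v + e.
  rewrite ler_norml; have := key _ _ h.
  have : f x' <= f x + e by apply: key => y; rewrite distrC.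
  by lra.
move=> /(horo_lip f); rewrite /horo => uv.
have : expR ((f u - f v) / 2) <= 1 + d * expR M.
  have -> : (f u - f v) / 2 = (f u - height f) / 2 + (height f - f v) / 2 by lra.
  rewrite expRD.
  have E : expR ((f v - height f) / 2) * expR ((height f - f v) / 2) = 1.
    by rewrite -expRD -[RHS]expR0; congr expR; lra.
  apply: (le_trans
    (y := (expR ((f v - height f) / 2) + d) * expR ((height f - f v) / 2))).
    by rewrite ler_pM2r ?expR_gt0.
  rewrite mulrDl E lerD2l ler_pM2l// ler_expR.
  by have := height_ub f v; rewrite ler_norml; lra.
have := expR_ge1Dx ((f u - f v) / 2).
have -> : d * expR M = e / 2 by rewrite /d -mulrA -expRD addNr expR0 mulr1.
by lra.
Qed.

(** Along an ultrafilter on a ball the functions converge pointwise, hence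
    uniformly by equicontinuity and compactness of Z, and the equation
    [dual f = f] passes to uniform limits. *)
Lemma ts_proper : proper_metric_space (tightSpan Z).
Proof.
move=> f0 r; rewrite compact_ultra => F UF FB; have PF := @ultra_proper _ F UF.
set B := [set f | mdist f0 f <= r] in FB.
pose M := height f0 + r.
have hM f : B f -> height f <= M.
  move=> f0f; have f0r : mdist f0 f <= r by [].
  have := metric_triangle f f0 ts_zero.
  by rewrite (metric_sym f f0) /M /height; lra.
have /choice[g gP] z : exists c : R,
    (fun f : tightSpan Z => f z) @ F --> c.
  have := @ultra_compact_cvg _ _ _ F (fun f : tightSpan Z => f z)
    (segment_compact (a := - M) (b := M)) UF.
  case=> [|c _ fc]; last by exists c.
  apply: filterS FB => f /hM fM.
  by rewrite /= in_itv /=; have := height_ub f z; rewrite ler_norml; lra.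
have gequi z e : 0 < e -> \forall z' \near z, `|g z - g z'| <= e.
  move=> e0; have e30 : 0 < e / 3 by rewrite divr_gt0.
  apply: filterS (ts_equicontinuous M z e30) => z' h.
  have /cvgrPdist_le/(_ _ e30) h1 := gP z.
  have /cvgrPdist_le/(_ _ e30) h2 := gP z'.
  have [f [[f1 f2] /hM f3]] := filter_ex (filterI (filterI h1 h2) FB).
  by move: f1 f2; have := h _ f3; rewrite !ler_norml; lra.
have unif e : 0 < e -> \forall f \near F, forall z, `|(f : tightSpan Z) z - g z| <= e.
  move=> e0; have e30 : 0 < e / 3 by rewrite divr_gt0.
  have /compact_near_coveringP nc := @ak_compact R Z.
  suff : \forall f \near F, [set: Z] `<=` (fun z => `|(f : tightSpan Z) z - g z| <= e).
    by apply: filterS => f + z; exact.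
  apply: nc => z _.
  have /cvgrPdist_le/(_ _ e30) h1 := gP z.
  exists ([set z' | (forall f, height f <= M -> `|f z - f z'| <= e / 3) /\
      `|g z - g z'| <= e / 3], [set f : tightSpan Z | `|g z - f z| <= e / 3 /\ B f]).
    split; last exact: filterI.
    by apply: filterI; [exact: ts_equicontinuous|exact: gequi].
  move=> [z' f] /= [[a1 a2] [a3 /hM a4]].
  by move: (a1 f a4) a2 a3; rewrite !ler_norml; lra.
have gM z : `|g z| <= M.
  apply/ler_addgt0Pl => e e0.
  have [f [f1 /hM f2]] := filter_ex (filterI (unif e e0) FB).
  by have := f1 z; have := height_ub f z; rewrite !ler_norml; lra.
have bg : sup_bounded g by exists M.
have dg z : dual g z = g z.
  apply/eqP; rewrite eq_le; apply/andP; split; apply/ler_addgt0Pl => e e0.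
    have [f fP] := filter_ex (unif (e / 2) (divr_gt0 e0 (ltr0n _ 2))).
    have : dual g z <= dual f z + e / 2.
      apply: dual_le_shift; [exact: ts_bounded|by []|move=> y].
      by have := fP y; rewrite ler_norml; lra.
    by rewrite ts_dual; have := fP z; rewrite ler_norml; lra.
  have [f fP] := filter_ex (unif (e / 2) (divr_gt0 e0 (ltr0n _ 2))).
  have : dual f z <= dual g z + e / 2.
    apply: dual_le_shift; [by []|exact: ts_bounded|move=> y].
    by have := fP y; rewrite ler_norml; lra.
  by rewrite ts_dual; have := fP z; rewrite ler_norml; lra.
pose G : tightSpan Z := TightSpan bg dg.
have dG e : 0 < e -> \forall f \near F, mdist f G <= e.
  by move=> e0; apply: filterS (unif e e0) => f fg; exact: ts_lub.
exists G; split=> /=.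
  apply/ler_addgt0Pr => e e0.
  have [f [f1 f2]] := filter_ex (filterI (dG e e0) FB).
  by have := metric_triangle f0 f G; move: f2; rewrite /B/=; lra.
apply/metricType_numDomainType.fcvgrPdist_lt => e e0.
have e20 : 0 < e / 2 by rewrite divr_gt0.
by apply: filterS (dG _ e20) => f; rewrite metric_sym; lra.
Qed.

(** Let x, y be the points of [dist_contact] for the ends of the segment, so that
    the value at x decreases and the one at y increases with unit speed.  After b,
    continue by adding t - b everywhere except at x, where t - b is subtracted.
    This is admissible because rho x x = 0, but not extremal; the
    retraction can only lower values, so the values at x and y stay below lines
    of slope -1 and 1.  Before a, the roles of x and y are exchanged.  As x and y
    are in contact, the sum of the two values is at least what it is at a, so both
    inequalities are equalities. *)
Lemma ts_complete : geodesically_complete (tightSpan Z).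
Proof.
move=> a b c ab isoc.
have [x [y [abx aby xya xyb]]] := dist_contact (c a) (c b).
have ain : `[a, b]%classic a by rewrite /= in_itv /= lexx.
have bin : `[a, b]%classic b by rewrite /= in_itv /= lexx ab.
have dab : mdist (c a) (c b) = b - a by rewrite isoc// ler0_norm; lra.
(* t = cl t + up t - dn t, with cl t in [a, b] *)
pose cl t := Num.min b (Num.max a t).
pose up t := Num.max 0 (t - b).
pose dn t := Num.max 0 (a - t).
have clin t : `[a, b]%classic (cl t).
  by rewrite /= in_itv /= /cl le_min ge_min ab le_max lexx /= lexx.
have tE t : t = cl t + up t - dn t.
  by rewrite /cl /up /dn minEle !maxEle; repeat case: ifPn; lra.
have mono s t : s <= t -> [/\ cl s <= cl t, up s <= up t & dn t <= dn s].
  by move=> st; rewrite /cl /up /dn !minEle !maxEle; split; repeat case: ifPn; lra.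
have up0 t : 0 <= up t by rewrite le_max lexx.
have dn0 t : 0 <= dn t by rewrite le_max lexx.
pose sg w z : R := if z == w then -1 else 1.
have sg1 w z : sg w z = 1 \/ sg w z = -1 by rewrite /sg; case: ifP; [right|left].
have sgxx w : sg w w = -1 by rewrite /sg eqxx.
pose u t z := c (cl t) z + up t * sg x z + dn t * sg y z.
have updn t : up t = 0 \/ dn t = 0.
  by rewrite /up /dn !maxEle; repeat case: ifPn; lra.
have gu t : admissible_le (height (c (cl t)) + up t + dn t) (u t).
  split=> [z|z z'].
    have := height_ub (c (cl t)) z; rewrite /u !ler_norml.
    by have := up0 t; have := dn0 t; case: (sg1 x z) => ->; case: (sg1 y z) => ->; lra.
  have [->|zz'] := eqVneq z z'; first by rewrite ak_rhoxx expR_ge0.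
  rewrite (le_trans (ts_rho (c (cl t)) z z'))// ler_expR ler_pM2r// /u.
  have sgs w : 0 <= sg w z + sg w z'.
    rewrite /sg; case: eqP => [zw|_]; case: eqP => [zw'|_]; try lra.
    by move: zz'; rewrite zw zw' eqxx.
  have := mulr_ge0 (up0 t) (sgs x); have := mulr_ge0 (dn0 t) (sgs y).
  by rewrite !mulrDr; lra.
pose c' t := ts_retract (gu t).
have c'in t : `[a, b]%classic t -> c' t = c t.
  move=> tin; have tab : a <= t <= b by move: tin; rewrite /= in_itv.
  have clt : cl t = t.
    by rewrite /cl minEle maxEle; repeat case: ifPn; lra.
  have u0 : up t = 0 by rewrite /up maxEle; case: ifPn; lra.
  have d0 : dn t = 0 by rewrite /dn maxEle; case: ifPn; lra.
  have ut : u t = c t.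
    by apply/funext => z; rewrite /u clt u0 d0 !mul0r !addr0.
  by apply: ts_eq => z /=; rewrite ut retract_id// => w; exact: ts_dual.
have lip s t : mdist (c' s) (c' t) <= `|s - t|.
  suff key s' t' : s' <= t' -> mdist (c' s') (c' t') <= t' - s'.
    have [st|/ltW ts] := leP s t.
      by rewrite ler0_norm ?key; have := key _ _ st; lra.
    by rewrite metric_sym ger0_norm; have := key _ _ ts; lra.
  move=> st; have [m1 m2 m3] := mono _ _ st.
  apply: ts_retract_lip => z; rewrite /u.
  have := ts_ub (c (cl s')) (c (cl t')) z.
  rewrite isoc// [X in _ <= X]ler0_norm; last by lra.
  have := tE s'; have := tE t'.
  by rewrite !ler_norml; case: (sg1 x z) => ->; case: (sg1 y z) => ->; lra.
(* values at x and at y lie below the lines with slopes -1 and 1 *)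
have bx t : c' t x <= c a x - (t - a).
  apply: (le_trans (retract_le x (gu t))); rewrite /u sgxx.
  have := ts_le (c (cl t)) (c b) x; rewrite isoc// ler0_norm; last first.
    by have := clin t; rewrite /= in_itv /=; lra.
  have := tE t; have := dn0 t.
  by case: (sg1 y x) => ->; lra.
have by_ t : c' t y <= c a y + (t - a).
  apply: (le_trans (retract_le y (gu t))); rewrite /u sgxx.
  have := ts_le (c (cl t)) (c a) y; rewrite isoc// ger0_norm; last first.
    by have := clin t; rewrite /= in_itv /=; lra.
  have := tE t; have := up0 t.
  by case: (sg1 x y) => ->; lra.
have ex t : c' t x = c a x - (t - a).
  apply/eqP; rewrite eq_le bx /=.
  have := ts_rho (c' t) x y; rewrite {1}xya ler_expR.
  by have := by_ t; lra.
exists c'; split=> // s t _ _; apply/eqP; rewrite eq_le lip /=.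
apply: le_trans (ts_ub (c' s) (c' t) x).
suff -> : `|s - t| = `|c' s x - c' t x| by [].
by rewrite !ex distrC; congr `|_|; lra.
Qed.

End Geometry.

(** * The compactification of the tight span *)

Lemma near_mdist (R : realType) (V : metricType R) (v : V) (e : R) : 0 < e ->
  \forall w \near v, mdist v w <= e.
Proof.
move=> e0; exact: (metricType_numDomainType.cvgr_dist_le (f := id) (F := nbhs v)).
Qed.

Lemma expR_lip_le0 (R : realType) (a b : R) : a <= 0 -> b <= 0 ->
  `|expR a - expR b| <= `|a - b|.
Proof.
move=> a0 b0.
have key (u v : R) : u <= 0 -> expR u - expR v <= `|u - v|.
  move=> u0; have := expR_ge1Dx (v - u).
  have -> : expR v = expR u * expR (v - u) by rewrite -expRD addrC subrK.
  have : expR u <= 1 by rewrite expR_le1.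
  have : 0 < expR u by exact: expR_gt0.
  have := ler_norm (u - v); move: (expR u) (expR (v - u)) => x y.
  have := normr_ge0 (u - v).
  move=> h1 h2 h3 h4 h5; have : x * (1 + (v - u)) <= x * y by rewrite ler_pM2l.
  have [h|h] := leP u v.
    have : 0 <= x * (v - u) by rewrite mulr_ge0; lra.
    by lra.
  have : x * (u - v) <= u - v by rewrite ler_piMl; lra.
  by lra.
by have := key a b a0; have := key b a b0; rewrite (distrC b) ler_norml; lra.
Qed.

Inductive tsHat (R : realType) (Z : antipodalKernel R) :=
  | HatIn of tightSpan Z
  | HatBd of Z.

Section Hat.
Context {R : realType} {Z : antipodalKernel R}.
Implicit Types (f g h p : tightSpan Z) (x y z : Z) (a b c : tsHat Z) (e d : R).

Local Notation rho := (@ak_rho R Z).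
Local Notation In := (@HatIn R Z).
Local Notation Bd := (@HatBd R Z).

(** exp (- (a|b)_p), where the distance of a point f to the boundary point x is
    taken to be f x, and that of two boundary points to be 2 ln (rho x y). *)
Definition hker p a b : R :=
  match a, b with
  | HatIn f, HatIn g => expR ((mdist f g - mdist p f - mdist p g) / 2)
  | HatIn f, HatBd x => expR ((f x - p x - mdist p f) / 2)
  | HatBd x, HatIn f => expR ((f x - p x - mdist p f) / 2)
  | HatBd x, HatBd y => expR (- (p x + p y) / 2) * rho x y
  end.

Lemma hkerC p a b : hker p a b = hker p b a.
Proof.
case: a b => [f|x] [g|y] //=; first by rewrite (metric_sym f) addrAC.
by rewrite ak_rhoC (addrC (p x)).
Qed.

Lemma hker_ge0 p a b : 0 <= hker p a b.
Proof.
by case: a b => [f|x] [g|y] /=; rewrite ?expR_ge0// mulr_ge0 ?expR_ge0 ?ak_rho_ge0.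
Qed.

Lemma hker_le1 p a b : hker p a b <= 1.
Proof.
have fx f x : expR ((f x - p x - mdist p f) / 2) <= 1.
  by rewrite expR_le1; have := ts_le f p x; rewrite (metric_sym f p); lra.
case: a b => [f|x] [g|y] //=.
  by rewrite expR_le1; have := metric_triangle f p g; rewrite (metric_sym f p); lra.
have := ts_rho p x y; rewrite mulNr expRN.
by rewrite ler_pdivrMl ?expR_gt0// mulr1.
Qed.

Local Notation hk := (hker ts_zero).

Lemma hk_InBd f x : hk (In f) (Bd x) = horo f x.
Proof. by rewrite /= subr0 /horo /height metric_sym. Qed.

Lemma hk_BdBd x y : hk (Bd x) (Bd y) = rho x y.
Proof. by rewrite /= addr0 oppr0 mul0r expR0 mul1r. Qed.

Lemma hk_InIn f g : hk (In f) (In g) = expR ((mdist f g - height f - height g) / 2).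
Proof. by rewrite /= /height (metric_sym f ts_zero) (metric_sym g ts_zero). Qed.

Lemma hk_InIn_diag f : hk (In f) (In f) = expR (- height f).
Proof. by rewrite hk_InIn mdistxx; congr expR; lra. Qed.

(** The change of base point
    (a|b)_p = (a|b)_0 + d(0, p) - (a|p)_0 - (b|p)_0. *)
Lemma hker_change p a b : hker p a b =
  hk a b * expR (- height p) / (hk a (In p) * hk b (In p)).
Proof.
have E f : hk (In f) (In p) != 0 by rewrite gt_eqF ?expR_gt0.
case: a b => [f|x] [g|y].
- rewrite !hk_InIn -!expRD -expRN -expRD; congr expR.
  by rewrite (metric_sym f p) (metric_sym g p); lra.
- rewrite hk_InIn hk_InBd (hkerC _ (Bd y)) hk_InBd /horo -!expRD -expRN -expRD.
  by congr expR; rewrite (metric_sym f p) /=; lra.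
- rewrite hk_InIn !(hkerC _ (Bd x)) !hk_InBd /horo -!expRD -expRN -expRD.
  by congr expR; rewrite (metric_sym g p) /=; lra.
- rewrite hk_BdBd !(hkerC _ _ (In p)) !hk_InBd /horo -!expRD -expRN.
  by rewrite -mulrA -expRD [LHS]mulrC; congr (_ * _); congr expR; lra.
Qed.

(** With this metric the kernel [hk] is 1-Lipschitz in each variable, so the
    continuity of Gromov products is built into the topology. *)
Definition hdist a b := sup (range (fun c => `|hk a c - hk b c|)).

Lemma hdist_has_sup a b : has_sup (range (fun c => `|hk a c - hk b c|)).
Proof.
split; first by exists `|hk a (In ts_zero) - hk b (In ts_zero)|, (In ts_zero).
exists 1 => _ [c _ <-]; rewrite ler_norml.
have := hker_ge0 ts_zero a c; have := hker_ge0 ts_zero b c.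
by have := hker_le1 ts_zero a c; have := hker_le1 ts_zero b c; lra.
Qed.

Lemma hdist_ub a b c : `|hk a c - hk b c| <= hdist a b.
Proof. by apply: (ub_le_sup (hdist_has_sup a b).2); exists c. Qed.

Lemma hdist_lub a b e : (forall c, `|hk a c - hk b c| <= e) -> hdist a b <= e.
Proof.
by move=> h; apply: (ge_sup (hdist_has_sup a b).1) => _ [c _ <-].
Qed.

Lemma hdistxx a : hdist a a = 0.
Proof.
apply/eqP; rewrite eq_le; apply/andP; split.
  by apply: hdist_lub => c; rewrite subrr normr0.
exact: le_trans (hdist_ub a a (In ts_zero)).
Qed.

Lemma hdist_sym a b : hdist a b = hdist b a.
Proof. by rewrite /hdist; congr sup; apply: eq_imagel => c _; exact: distrC. Qed.

Lemma hdist_triangle b a c : hdist a c <= hdist a b + hdist b c.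
Proof.
apply: hdist_lub => q; rewrite -(subrKA (hk b q)).
by rewrite (le_trans (ler_normD _ _))// lerD// hdist_ub.
Qed.

Lemma hdist_In_Bd f x : expR (- height f) <= hdist (In f) (Bd x).
Proof.
apply: le_trans (hdist_ub _ _ (Bd x)); rewrite hk_InBd hk_BdBd ak_rhoxx subr0.
rewrite ger0_norm ?expR_ge0// ler_expR.
by have := height_ub f x; rewrite ler_norml; lra.
Qed.

Lemma hdist_positivity a b : hdist a b = 0 -> a = b.
Proof.
move=> ab0; have ab c : hk a c = hk b c.
  by apply/eqP; rewrite -subr_eq0 -normr_le0 -ab0 hdist_ub.
case: a b ab0 ab => [f|x] [g|y] ab0 ab.
- have hfg : height f = height g.
    apply: oppr_inj; apply: expR_inj; rewrite -!hk_InIn_diag.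
    by rewrite [LHS]ab hkerC ab.
  congr HatIn; apply: ts_eq => z; have := ab (Bd z); rewrite !hk_InBd /horo hfg.
  by move=> /expR_inj; lra.
- by have := hdist_In_Bd f y; rewrite ab0 leNgt expR_gt0.
- by have := hdist_In_Bd g x; rewrite hdist_sym ab0 leNgt expR_gt0.
- by congr HatBd; apply/ak_rho_eq0; rewrite -hk_BdBd ab hk_BdBd ak_rhoxx.
Qed.

HB.instance Definition _ := gen_eqMixin (tsHat Z).
HB.instance Definition _ := gen_choiceMixin (tsHat Z).
HB.instance Definition _ := isMetric.Build R (tsHat Z)
  hdistxx hdist_positivity hdist_sym hdist_triangle.
HB.instance Definition _ := isPointed.Build (tsHat Z) (In ts_zero).

Lemma hat_cvgP (T : Type) (F : set_system T) (FF : Filter F) (u : T -> tsHat Z) a :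
  u @ F --> a <-> forall e, 0 < e -> \forall t \near F, hdist a (u t) <= e.
Proof. exact: metricType_numDomainType.cvgrPdist_le. Qed.

Lemma lowest_point f : exists x, f x = - height f.
Proof.
have [_ [x [_ + _ _]]] := dist_contact f ts_zero.
by rewrite /= subr0 => fx; exists x.
Qed.

(** The lowest point x represents f seen from far away: Gromov products with f
    and with x agree up to a small error when f is high ([rho_le_horo],
    [horo_le_rho], [hk_high]). *)
Lemma rho_le_horo f x z : f x = - height f -> rho x z <= horo f z.
Proof.
by move=> fx; rewrite (le_trans (ts_rho f x z))// ler_expR fx; lra.
Qed.

Lemma exp_small d : 0 < d -> exists T : R, forall t, T <= t -> expR (- t) <= d.
Proof.
by move=> d0; exists (- ln d) => t; rewrite -{2}(lnK (d0 : d \is Num.pos)) ler_expR; lra.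
Qed.

(** Let y be in contact with z for f.  If [horo f z] is not small, then f y is
    nearly as low as f x, so rho x y is small and rho z y is close to rho z x. *)
Lemma horo_le_rho e : 0 < e -> exists T, forall f x, f x = - height f ->
  T <= height f -> forall z, horo f z <= rho x z + e.
Proof.
move=> e0; have [d d0 hd] := rho_close_diag (Z := Z) e0.
have [T hT] := exp_small (mulr_gt0 d0 e0); exists T => f x fx Tf z.
have [small|big] := leP (horo f z) e; first by have := ak_rho_ge0 x z; lra.
have [y zy] := contact f z.
have fzy : f y <= - f z.
  have := ak_rho_le1 z y; rewrite zy expR_le1; lra.
have xy : rho x y <= d.
  apply: (le_trans (ts_rho f x y)).
  have -> : d = d * e / e by rewrite mulfK// gt_eqF.
  rewrite ler_pdivlMr//.
  apply: le_trans (hT _ Tf); apply: (le_trans (y := expR ((f x + f y) / 2) * horo f z)).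
    by rewrite ler_pM2l ?expR_gt0// ltW.
  by rewrite /horo -expRD ler_expR fx; lra.
have : rho z y <= rho x z + e.
  by have := hd _ _ xy z; rewrite ler_norml (ak_rhoC y z); lra.
apply: le_trans; rewrite zy ler_expR.
by have := height_ub f y; rewrite ler_norml; lra.
Qed.

(** Let the distance of f and g be attained at z.  Then the kernel at f and g is
    [horo f z] times a factor; if the factor is not small, then g z is
    nearly as low as g x, so z is close to x. *)
Lemma hk_high e : 0 < e -> exists T, forall f g x, g x = - height g ->
  T <= height g -> `|hk (In f) (In g) - horo f x| <= e.
Proof.
move=> e0; have [d d0 hd] := rho_close_diag (Z := Z) e0.
have [T hT] := exp_small (mulr_gt0 d0 e0); exists T => f g x gx Tg.
have lo : horo f x <= hk (In f) (In g).
  rewrite hk_InIn ler_expR; have := ts_ub f g x; rewrite gx ler_norml; lra.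
rewrite ger0_norm ?subr_ge0// lerBlDl.
have [z [_ [fgz _ _ _]]] := dist_contact f g.
have E : hk (In f) (In g) = horo f z * expR (- (g z + height g) / 2).
  by rewrite hk_InIn /horo -expRD -fgz; congr expR; lra.
have le1 : expR (- (g z + height g) / 2) <= 1.
  by rewrite expR_le1; have := height_ub g z; rewrite ler_norml; lra.
have [small|big] := leP (expR (- (g z + height g) / 2)) e.
  have : hk (In f) (In g) <= e.
    by rewrite E -[leRHS]mul1r ler_pM// ?expR_ge0// horo_le1.
  by have := horo_gt0 f x; lra.
have xz : rho x z <= d.
  apply: (le_trans (ts_rho g x z)).
  have -> : d = d * e / e by rewrite mulfK// gt_eqF.
  rewrite ler_pdivlMr//.
  apply: le_trans (hT _ Tg).
  apply: (le_trans (y := expR ((g x + g z) / 2) * expR (- (g z + height g) / 2))).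
    by rewrite ler_pM2l ?expR_gt0// ltW.
  by rewrite -expRD ler_expR gx; lra.
have : horo f z <= horo f x + e.
  by apply: horo_lip => y; rewrite distrC hd.
by apply: le_trans; rewrite E -[leRHS]mulr1 ler_pM2l ?horo_gt0.
Qed.

Lemma hdist_high e : 0 < e -> exists T, forall g x, g x = - height g ->
  T <= height g -> hdist (In g) (Bd x) <= e.
Proof.
move=> e0; have [T1 h1] := hk_high e0; have [T2 h2] := horo_le_rho e0.
exists (Num.max T1 T2) => g x gx; rewrite ge_max => /andP[g1 g2].
apply: hdist_lub => -[f|z].
  by rewrite hkerC (hkerC _ _ (In f)) hk_InBd h1.
rewrite hk_InBd hk_BdBd.
by have := h2 g x gx g2 z; have := rho_le_horo z gx; rewrite ler_norml; lra.
Qed.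

Lemma Bd_continuous : continuous Bd.
Proof.
move=> x; apply/hat_cvgP => e e0; apply: filterS (rho_near_unif x e0) => x' xx'.
apply: hdist_lub => -[f|z]; last by rewrite !hk_BdBd.
rewrite !(hkerC _ _ (In f)) !hk_InBd.
have := horo_lip f xx'.
have : horo f x' <= horo f x + e by apply: horo_lip => y; rewrite distrC.
by rewrite ler_norml; lra.
Qed.

Lemma In_lip f g : hdist (In f) (In g) <= mdist f g.
Proof.
have fg : `|height f - height g| <= mdist f g.
  have := metric_triangle f g ts_zero; have := metric_triangle g f ts_zero.
  by rewrite (metric_sym g f) /height ler_norml; lra.
apply: hdist_lub => -[h|z].
  rewrite !hk_InIn.
  have le0 k : (mdist k h - height k - height h) / 2 <= 0.
    have := metric_triangle k ts_zero h; rewrite (metric_sym ts_zero h) /height.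
    by lra.
  apply: (le_trans (expR_lip_le0 (le0 f) (le0 g))).
  have := metric_triangle f g h; have := metric_triangle g f h.
  by move: fg; rewrite (metric_sym g f) !ler_norml; lra.
rewrite !hk_InBd /horo.
have le0 (k : tightSpan Z) : (k z - height k) / 2 <= 0.
  by have := height_ub k z; rewrite ler_norml; lra.
apply: (le_trans (expR_lip_le0 (le0 f) (le0 g))).
by move: fg (ts_ub f g z); rewrite !ler_norml; lra.
Qed.

Lemma In_continuous : continuous In.
Proof.
move=> f; apply: (hat_cvgP (nbhs_filter f) In (In f)).2 => e e0.
by apply: filterS (near_mdist f e0) => g; apply: le_trans; exact: In_lip.
Qed.

(** The kernel recovers the distances: it takes the values exp (- height f) at
    (f, f) and exp ((d(f, g) - height f - height g) / 2) at (f, g), and it is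
    bounded below at f and a boundary point by exp (- height f). *)
Lemma In_expansive f e : 0 < e -> exists2 d, 0 < d &
  forall b, hdist (In f) b < d -> exists2 g, b = In g & mdist f g < e.
Proof.
move=> e0; pose m := expR (- height f); have m0 : 0 < m by exact: expR_gt0.
(* d <= m / 4 excludes boundary points and keeps s above m / 2, while
   d <= m e / 8 bounds the distance by e *)
pose d := Num.min (m / 4) (m * e / 8).
have d0 : 0 < d.
  by rewrite /d lt_min !divr_gt0 ?mulr_gt0.
have dm : d <= m / 4 by rewrite /d ge_min lexx.
have de : d <= m * e / 8 by rewrite /d ge_min lexx orbT.
exists d => // -[g|x] fb; last first.
  by have := hdist_In_Bd f x; rewrite -/m; lra.
exists g => //.
have h1 := hdist_ub (In f) (In g) (In f).
have h2 := hdist_ub (In f) (In g) (In g).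
rewrite (hkerC _ (In g) (In f)) in h1.
move: h1 h2; rewrite !hk_InIn_diag -/m hk_InIn.
set n := expR (- height g); pose s := expR (- (height f + height g) / 2).
have -> : expR ((mdist f g - height f - height g) / 2) = expR (mdist f g / 2) * s.
  by rewrite -expRD; congr expR; lra.
have s0 : 0 < s by exact: expR_gt0.
have mns : m <= s \/ n <= s.
  rewrite /m /n /s !ler_expR.
  by have [h|h] := leP (height f) (height g); [right|left]; lra.
have := expR_ge1Dx (mdist f g / 2); set E := expR (mdist f g / 2) => E1.
have mfg : 0 <= mdist f g by exact: mdist_ge0.
have s1 : s <= E * s by rewrite ler_peMl//; [exact: ltW|lra].
have s2 : (1 + mdist f g / 2) * s <= E * s by rewrite ler_pM2r.
rewrite !ler_norml => h1 h2.
have sm : m / 2 <= s by case: mns; lra.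
have s3 : mdist f g / 2 * s <= d by case: mns; lra.
have : mdist f g / 2 * (m / 2) <= d.
  by apply: le_trans s3; rewrite ler_wpM2l//; lra.
move=> h3; rewrite -(ltr_pM2l m0).
have : 0 < m * e by rewrite mulr_gt0.
by lra.
Qed.

Lemma In_embedding : topological_embedding In.
Proof.
split=> [f g [//]|A]; split=> [oA|[B oB <-]]; last first.
  by apply: open_comp => // f _; exact: In_continuous.
exists (In @` A); last first.
  by apply/seteqP; split=> [f [g Ag [<-]]//|f Af]; exists f.
rewrite openE => _ [f Af <-].
have : nbhs f A by exact: open_nbhs_nbhs.
rewrite -metricType_numDomainType.filter_from_mdist_nbhs => -[e /= e0 eA].
have [d d0 hd] := In_expansive f e0.
rewrite /interior -metricType_numDomainType.filter_from_mdist_nbhs.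
by exists d => // b /= /hd[g -> fg]; exists g => //; exact: eA.
Qed.

(** The retraction of the function - T at x and T elsewhere: the points on
    the geodesic ray from the base point to x. *)
Lemma high_point x T : 0 <= T -> exists f, height f = T /\ f x = - T.
Proof.
move=> T0; pose u z : R := if z == x then - T else T.
have gu : admissible_le T u.
  split=> [z|z z'].
    by rewrite /u; case: ifP; rewrite ?normrN ger0_norm.
  have [->|zz'] := eqVneq z z'; first by rewrite ak_rhoxx expR_ge0.
  rewrite (le_trans (ak_rho_le1 z z'))// -[leLHS]expR0 ler_expR /u.
  case: eqP => [zx|_]; case: eqP => [zx'|_]; try lra.
  by move: zz'; rewrite zx zx' eqxx.
have fx : ts_retract gu x <= - T.
  by apply: (le_trans (retract_le x gu)); rewrite /u eqxx.
have hT : height (ts_retract gu) <= T.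
  by apply: ts_lub => z /=; rewrite subr0; exact: retract_bound.
exists (ts_retract gu).
have := height_ub (ts_retract gu) x; rewrite ler_norml => h; split; lra.
Qed.

Lemma In_dense : dense (range In).
Proof.
move=> O [[f|x] Oa] oO; first by exists (In f); split => //; exists f.
have : nbhs (Bd x) O by exact: open_nbhs_nbhs.
rewrite -metricType_numDomainType.filter_from_mdist_nbhs => -[e /= e0 eO].
have e20 : 0 < e / 2 by rewrite divr_gt0.
have [T hT] := hdist_high e20.
have T0 : 0 <= Num.max 0 T by rewrite le_max lexx.
have [f [hf fx]] := high_point x T0.
exists (In f); split; last by exists f.
apply: eO; change (hdist (Bd x) (In f) < e).
have : hdist (In f) (Bd x) <= e / 2 by rewrite hT ?hf// le_max lexx orbT.
by rewrite hdist_sym; lra.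
Qed.

(** An ultrafilter either contains the image of a ball, which is compact, or
    leaves every ball; in the latter case it converges to the limit in Z of the
    lowest points. *)
Lemma hat_compact : compact [set: tsHat Z].
Proof.
rewrite compact_ultra => F UF _; have PF := @ultra_proper _ F UF.
have [[r Fr]|nb] := pselect (exists r, F (In @` [set f | mdist ts_zero f <= r])).
  have : compact (In @` [set f | mdist ts_zero f <= r]).
    apply: continuous_compact; last exact: ts_proper.
    exact/continuous_subspaceT/In_continuous.
  by rewrite compact_ultra => /(_ F UF Fr) [a [_ Fa]]; exists a.
have /choice[pi piP] a : exists x,
    match a with HatIn f => f x = - height f | HatBd y => x = y end.
  case: a => [f|y]; first exact: lowest_point.
  by exists y.
have [x _ Fx] := ultra_compact_cvg (h := pi) (@ak_compact R Z) UF filterT.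
have FBd : (Bd \o pi) @ F --> Bd x.
  by apply: continuous_cvg => //; exact: Bd_continuous.
exists (Bd x); split => //.
suff : id @ F --> Bd x by [].
apply/hat_cvgP => e e0; have e20 : 0 < e / 2 by rewrite divr_gt0.
have [T hT] := hdist_high e20.
have /hat_cvgP/(_ _ e20) near1 := FBd.
have near2 : F (~` (In @` [set f | mdist ts_zero f <= T])).
  have [h|//] := in_ultra_setVsetC (In @` [set f | mdist ts_zero f <= T]) UF.
  by case: nb; exists T.
apply: filterS2 near1 near2 => a h1 h2.
apply: (le_trans (hdist_triangle (Bd (pi a)) _ _)).
suff : hdist a (Bd (pi a)) <= e / 2 by move: h1; rewrite /= (hdist_sym (Bd (pi a))); lra.
case: a h2 (piP a) {h1} => [f|y] h2 pa; last by rewrite pa hdistxx ltW.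
apply: hT => //; rewrite leNgt; apply/negP => fT; apply: h2.
by exists f => //=; rewrite metric_sym ltW.
Qed.

Lemma hat_second_countable : @second_countable (tsHat Z).
Proof. exact: compact_second_countable hat_compact. Qed.

Lemma hk_continuous : continuous (fun q : tsHat Z * tsHat Z => hk q.1 q.2).
Proof.
move=> [a b]; apply/cvgrPdist_le => e e0; have e20 : 0 < e / 2 by rewrite divr_gt0.
have na (c : tsHat Z) : \forall c' \near c, hdist c c' <= e / 2.
  exact: near_mdist.
exists ([set a' | hdist a a' <= e / 2], [set b' | hdist b b' <= e / 2]) => /=.
  by split; exact: na.
move=> [a' b'] /= [aa' bb'].
have := hdist_ub a a' b; have := hdist_ub b b' a'.
by rewrite !(hkerC _ _ a') !ler_norml; lra.
Qed.

Lemma hker_continuous p : continuous (fun q : tsHat Z * tsHat Z => hker p q.1 q.2).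
Proof.
have -> : (fun q : tsHat Z * tsHat Z => hker p q.1 q.2) = fun q =>
    hk q.1 q.2 * expR (- height p) / (hk q.1 (In p) * hk q.2 (In p)).
  by apply/funext => q; exact: hker_change.
have c1 a : {for a, continuous (fun a => hk a (In p))}.
  apply/(@cvgrPdist_le _ _ _ _ (nbhs_filter a)) => e e0.
  apply: filterS (near_mdist a e0) => a'.
  exact: le_trans (hdist_ub a a' (In p)).
have n0 a : hk a (In p) != 0 by rewrite gt_eqF//; case: a => [f|x]; exact: expR_gt0.
move=> [a b]; apply: cvgM.
  by apply: cvgM; [exact: hk_continuous|exact: cvg_cst].
apply: cvgV; first by rewrite mulf_neq0.
apply: cvgM.
  apply: (@continuous_comp _ _ _ fst (fun a => hk a (In p)) (a, b)).
    exact: cvg_fst.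
  exact: c1.
apply: (@continuous_comp _ _ _ snd (fun a => hk a (In p)) (a, b)).
  exact: cvg_snd.
exact: c1.
Qed.

End Hat.

(** * Gromov products as kernels with values in [0, 1] *)

Definition mexp (R : realType) (v : \bar R) : R := fine (expeR (- v)).

(** The value +oo on the negative half-line makes this inverse of [mexp]
    continuous on the whole line. *)
Definition mlog (R : realType) (t : R) : \bar R :=
  if t <= 0 then +oo%E else (- ln t)%:E.

Section ExtendedLog.
Context {R : realType}.
Implicit Types (t r : R) (v : \bar R).

Lemma mexp_EFin r : mexp r%:E = expR (- r). Proof. by []. Qed.

Lemma mexp_pinfty : mexp (+oo%E : \bar R) = 0. Proof. by []. Qed.

Lemma mexp_ge0 v : 0 <= mexp v.
Proof. by rewrite /mexp fine_ge0// expeR_ge0. Qed.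

Lemma mexp_le1 v : (0 <= v)%E -> mexp v <= 1.
Proof.
case: v => [r| |//] v0; last by rewrite mexp_pinfty.
by rewrite mexp_EFin expR_le1 oppr_le0 -lee_fin.
Qed.

Lemma mexp_eq0 v : (0 <= v)%E -> mexp v = 0 <-> v = +oo%E.
Proof.
case: v => [r| |//] v0; split=> //.
by rewrite mexp_EFin => /eqP; rewrite gt_eqF// expR_gt0.
Qed.

Lemma mlogK t : 0 <= t -> mexp (mlog t) = t.
Proof.
rewrite le_eqVlt /mlog => /orP[/eqP<-|t0]; first by rewrite lexx mexp_pinfty.
by rewrite leNgt t0 /= mexp_EFin opprK lnK.
Qed.

Lemma mlog_expR r : mlog (expR r) = (- r)%:E.
Proof. by rewrite /mlog leNgt expR_gt0 /= expRK. Qed.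

Lemma mlog_eqy t : mlog t = +oo%E <-> t <= 0.
Proof. by rewrite /mlog; case: ifP. Qed.

Lemma mlog_ge0 t : t <= 1 -> (0 <= mlog t)%E.
Proof.
move=> t1; rewrite /mlog; case: (leP t 0) => t0; first exact: leey.
by rewrite lee_fin oppr_ge0 ln_le0.
Qed.

Lemma mexp_continuous v : (0 <= v)%E -> {for v, continuous (@mexp R)}.
Proof.
case: v => [r| |//] v0.
  have c : {for r, continuous (fun s : R => expR (- s))}.
    by apply: continuous_comp; [exact: continuousN|exact: continuous_expR].
  by move=> A /c h.
apply/(@cvgrPdist_le _ _ _ _ (ereal_nbhs_filter +oo%E)) => e e0.
exists (- ln e); split; first exact: num_real.
case=> [s| |//] sM.
  rewrite mexp_pinfty sub0r normrN ger0_norm ?mexp_ge0// mexp_EFin.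
  rewrite -[leRHS](lnK (e0 : e \is Num.pos)) ler_expR.
  by move: sM; rewrite lte_fin; lra.
by rewrite subrr normr0 ltW.
Qed.

Lemma mlog_continuous : continuous (@mlog R).
Proof.
move=> t; have [t0|t0] := ltP 0 t.
  have E : \forall s \near t, (- ln s)%:E = mlog s.
    near=> s; rewrite /mlog leNgt ifN// negbK.
    by near: s; exact: lt_nbhsr.
  apply: (cvg_trans (near_eq_cvg E)); rewrite /mlog leNgt t0 /=.
  apply: cvg_EFin; first by near=> s.
  by apply: cvgN; exact: continuous_ln.
rewrite /continuous_at; have -> : mlog t = +oo%E by apply/mlog_eqy.
apply/cvgeyPge => A; near=> s; rewrite /mlog; case: (leP s 0) => s0; first exact: leey.
have : s < expR (- A).
  by near: s; apply: lt_nbhsl; exact: (le_lt_trans t0 (expR_gt0 _)).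
by rewrite -{1}(lnK (s0 : s \is Num.pos)) ltr_expR lee_fin; lra.
Unshelve. all: by end_near. Qed.

End ExtendedLog.

Lemma mul_continuous (R : realType) (T : topologicalType) (u w : T -> R) :
  continuous u -> continuous w -> continuous (fun t => u t * w t).
Proof. by move=> cu cw t; apply: cvgM; [exact: cu|exact: cw]. Qed.

Lemma dense_le (R : realType) (T : topologicalType) (D : set T) (u v : T -> R) :
  dense D -> continuous u -> continuous v ->
  (forall t, D t -> u t <= v t) -> forall t, u t <= v t.
Proof.
move=> dD cu cv uv t; rewrite leNgt; apply/negP => vu.
have : nbhs t [set s | v s < u s].
  have c : {for t, continuous (fun s => u s - v s)}.
    by apply: cvgB; [exact: cu|exact: cv].
  have : 0 < u t - v t by rewrite subr_gt0.
  by move=> /(cvgr_gt _ c); apply: filterS => s; rewrite subr_gt0.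
rewrite nbhsE => -[V [oV Vt] Vuv].
have [s [Vs Ds]] := dD V (ex_intro _ t Vt) oV.
by have := Vuv s Vs; rewrite /= ltNge uv.
Qed.

Lemma dense_eq (R : realType) (T : topologicalType) (D : set T) (u v : T -> R) :
  dense D -> continuous u -> continuous v ->
  (forall t, D t -> u t = v t) -> forall t, u t = v t.
Proof.
move=> dD cu cv uv t; apply/eqP; rewrite eq_le.
by rewrite !(@dense_le _ _ D)// => s /uv ->.
Qed.

Lemma dense_prod (T U : topologicalType) (D : set T) (E : set U) :
  dense D -> dense E -> dense (D `*` E).
Proof.
move=> dD dE O [[t u] Otu] oO.
have : nbhs (t, u) O by exact: open_nbhs_nbhs.
case=> -[A B] /= [At Bu] AB; move: At Bu; rewrite !nbhsE.
move=> [A' [oA At] A'A] [B' [oB Bu] B'B].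
have [s [As Ds]] := dD A' (ex_intro _ t At) oA.
have [w [Bw Ew]] := dE B' (ex_intro _ u Bu) oB.
by exists (s, w); split=> //; apply: AB; split; [exact: A'A|exact: B'B].
Qed.

(** The topology of a subtype is the initial one. *)
Lemma set_type_cvg (T : topologicalType) (A : set T) (F : set_system (set_type A))
    (FF : Filter F) (x : set_type A) :
  set_val @ F --> (set_val x : T) -> F --> x.
Proof.
move=> Fx U; rewrite nbhsE => -[W [[V oV VW] Wx] WU].
apply: (filterS WU); rewrite -VW.
by apply: Fx; apply: open_nbhs_nbhs; split=> //; rewrite -VW in Wx.
Qed.

Lemma set_type_compact (T : topologicalType) (A : set T) :
  compact A -> compact [set: set_type A].
Proof.
move=> cA; rewrite compact_ultra => F UF _; have PF := @ultra_proper _ F UF.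
have [|a Aa Fa] := ultra_compact_cvg (h := set_val) cA UF.
  by apply: filterS filterT => x _; exact: set_valP.
exists (exist _ a (mem_set Aa)); split=> //.
by apply: set_type_cvg; rewrite set_valE.
Qed.

Lemma set_val_continuous (T : topologicalType) (A : set T) :
  continuous (set_val : set_type A -> T).
Proof. exact: initial_continuous. Qed.

Section GromovKernel.
Context {R : realType} {X : gromovProductSpace R}.
Implicit Types (o x y z : X) (a b c : gps_hat X) (xi eta : gp_boundary X).

Local Notation i := (@gps_incl R X).
Local Notation v := (@gp_boundary_val R X).

(** exp (- (a|b)_x).  It takes real values in [0, 1], so that identities between
    Gromov products which hold on X extend to the compactification by density. *)
Definition gk x a b : R := mexp (gps_product x a b).

Lemma gp_rhoE x xi eta : gp_rho x xi eta = gk x (v xi) (v eta).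
Proof. by []. Qed.

Lemma gk_incl x y z : gk x (i y) (i z) = expR (- gromov_product x y z).
Proof. by rewrite /gk gps_product_incl. Qed.

Lemma gk_ge0 x a b : 0 <= gk x a b. Proof. exact: mexp_ge0. Qed.

Lemma gk_le1 x a b : gk x a b <= 1.
Proof. exact/mexp_le1/gps_product_ge0. Qed.

Lemma gk_continuous x : continuous (fun q : gps_hat X * gps_hat X => gk x q.1 q.2).
Proof.
move=> q; apply: (@continuous_comp _ _ _ (fun q => gps_product x q.1 q.2) (@mexp R)).
  exact: gps_product_continuous.
exact/mexp_continuous/gps_product_ge0.
Qed.

Lemma gk_comp (T : topologicalType) x (u w : T -> gps_hat X) :
  continuous u -> continuous w -> continuous (fun t => gk x (u t) (w t)).
Proof.
move=> cu cw t.
apply: (@continuous_comp _ _ _ (fun t => (u t, w t)) (fun q => gk x q.1 q.2)).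
  by apply: cvg_pair => /=; [exact: cu|exact: cw].
exact: gk_continuous.
Qed.

Lemma gk_continuousl x b : continuous (gk x ^~ b).
Proof. by apply: gk_comp => t; [exact: cvg_id|exact: cvg_cst]. Qed.

Lemma hat_dense2 (u w : gps_hat X * gps_hat X -> R) :
  continuous u -> continuous w ->
  (forall y z, u (i y, i z) = w (i y, i z)) -> forall q, u q = w q.
Proof.
move=> cu cw uw.
have dX := @gps_incl_dense R X.
apply: (dense_eq (dense_prod dX dX)) => //.
by move=> [_ _] /= [[y _ <-] [z _ <-]].
Qed.

Lemma gkC x a b : gk x a b = gk x b a.
Proof.
apply: (@hat_dense2 (fun q => gk x q.1 q.2) (fun q => gk x q.2 q.1) _ _ _ (a, b)).
- exact: gk_continuous.
- by apply: gk_comp => q; [exact: cvg_snd|exact: cvg_fst].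
- move=> y z /=; rewrite !gk_incl /gromov_product (metric_sym y z).
  by congr expR; lra.
Qed.

(** The change of base point, as in [hker_change]; on X it only involves
    distances. *)
Lemma gk_change x y a b :
  gk y a b * (gk x a (i y) * gk x b (i y)) = gk x a b * expR (- mdist x y).
Proof.
have c1 : continuous (fun q : gps_hat X * gps_hat X => q.1) by move=> q; exact: cvg_fst.
have c2 : continuous (fun q : gps_hat X * gps_hat X => q.2) by move=> q; exact: cvg_snd.
have ck : continuous (fun q : gps_hat X * gps_hat X => i y) by move=> q; exact: cvg_cst.
apply: (@hat_dense2 (fun q => gk y q.1 q.2 * (gk x q.1 (i y) * gk x q.2 (i y)))
  (fun q => gk x q.1 q.2 * expR (- mdist x y)) _ _ _ (a, b)).
- apply: mul_continuous; first by apply: gk_comp.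
  by apply: mul_continuous; apply: gk_comp.
- apply: mul_continuous; first by apply: gk_comp.
  by move=> q; exact: cvg_cst.
- move=> z w /=; rewrite !gk_incl /gromov_product -!expRD; congr expR.
  by rewrite (metric_sym y z) (metric_sym y w); lra.
Qed.

Lemma gk_base x a : gk x (i x) a = 1.
Proof.
apply: (@dense_eq _ _ _ (gk x (i x)) (fun=> 1) (@gps_incl_dense R X)).
- by apply: gk_comp => t; [exact: cvg_cst|exact: cvg_id].
- by move=> t; exact: cvg_cst.
- move=> _ [y _ <-]; rewrite gk_incl /gromov_product mdistxx.
  by rewrite add0r subrr mul0r oppr0 expR0.
Qed.

Lemma gk_point_ge x y a : expR (- mdist x y) <= gk x a (i y).
Proof.
apply: (@dense_le _ _ _ (fun=> expR (- mdist x y)) (gk x ^~ (i y)) (@gps_incl_dense R X)).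
- by move=> t; exact: cvg_cst.
- exact: gk_continuousl.
- move=> _ [z _ <-]; rewrite gk_incl ler_expR /gromov_product.
  by have := metric_triangle x y z; rewrite (metric_sym z y); lra.
Qed.

Lemma gk_point_gt0 x y a : 0 < gk x a (i y).
Proof. exact: lt_le_trans (expR_gt0 _) (gk_point_ge x y a). Qed.

(** For a in X this is the triangle inequality d(a, y) <= d(a, z) + d(z, y). *)
Lemma gk_shift x y z a : gk x a (i y) <=
  gk x a (i z) * expR ((mdist y z + mdist x z - mdist x y) / 2).
Proof.
apply: (@dense_le _ _ _ (gk x ^~ (i y)) (fun a => gk x a (i z) *
  expR ((mdist y z + mdist x z - mdist x y) / 2)) (@gps_incl_dense R X)).
- exact: gk_continuousl.
- by move=> t; apply: cvgM; [exact: gk_continuousl|exact: cvg_cst].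
- move=> _ [w _ <-]; rewrite !gk_incl -expRD ler_expR /gromov_product.
  by have := metric_triangle w z y; have := metric_sym y z; lra.
Qed.

(** (a|a)_x is a distance, hence finite, when a is in X. *)
Lemma gk_diag x a : gk x a a = 0 <-> (~` range i) a.
Proof.
split=> [a0 [y _ ya]|bda].
  by move: a0; rewrite -ya gk_incl => /eqP; rewrite gt_eqF// expR_gt0.
by apply/mexp_eq0; [exact: gps_product_ge0|exact/gps_product_boundary].
Qed.

Lemma gk_boundary x xi eta : gk x (v xi) (v eta) = 0 <-> xi = eta.
Proof.
have bd (z : gp_boundary X) : (~` range i) (v z) by exact: set_valP.
split=> [|->]; last exact/(gk_diag x).
move=> /(mexp_eq0 (gps_product_ge0 _ _ _)) /gps_product_boundary.
by move=> /(_ (bd xi) (bd eta)); exact: val_inj.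
Qed.

Lemma gps_inhabited (a : gps_hat X) : exists x : X, True.
Proof.
have [_ [_ [x _ _]]] := @gps_incl_dense R X setT (ex_intro _ a I) openT.
by exists x.
Qed.

Lemma boundary_set_compact x : compact (~` range i).
Proof.
apply: (subclosed_compact _ (@gps_hat_compact R X)) => //.
have -> : ~` range i = (fun a => gk x a a) @^-1` [set 0].
  by apply/seteqP; split=> a /= /(gk_diag x).
have c : continuous (fun a => gk x a a) by apply: gk_comp => t; exact: cvg_id.
by apply: preimage_closed; [move=> a _; exact: c|exact: closed_eq].
Qed.

Lemma boundary_compact x : compact [set: gp_boundary X].
Proof. exact/set_type_compact/(boundary_set_compact x). Qed.

Lemma boundary_point a : (~` range i) a -> exists xi, v xi = a.
Proof. by move=> ha; exists (exist _ a (mem_set ha)); rewrite /v set_valE. Qed.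

(** Continue a geodesic from y to y' to infinity and let xi be a limit point: the
    Gromov product at y of y' with the points of the ray beyond y' is constant. *)
Lemma ray_end y y' : exists xi, gk y (v xi) (i y') = expR (- mdist y y').
Proof.
have [c [isoc c0 cd]] := @gps_geodesic R X y y'.
have [c' [isoc' c'c]] := @gps_complete R X 0 _ c (mdist_ge0 y y') isoc.
have c'0 : c' 0 = y by rewrite c'c// /= in_itv /= lexx mdist_ge0.
have c'd : c' (mdist y y') = y' by rewrite c'c// /= in_itv /= lexx mdist_ge0.
have [U [UU sU]] := ultraFilterLemma (@proper_pinfty_nbhs R).
have PU := @ultra_proper _ U UU.
have [a _ Ua] := ultra_compact_cvg (h := i \o c') (@gps_hat_compact R X) UU filterT.
have lim (w : R -> gps_hat X) b : w @ U --> b ->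
    (fun t => gk y (i (c' t)) (w t)) @ U --> gk y a b.
  move=> wb.
  apply: (cvg_comp (fun t => (i (c' t), w t)) (fun q => gk y q.1 q.2)).
    exact: (cvg_pair Ua wb).
  exact: (@gk_continuous y (a, b)).
have bda : (~` range i) a.
  apply/(gk_diag y).
  have h1 := lim _ _ Ua.
  have h2 : (fun t => gk y (i (c' t)) ((i \o c') t)) @ U --> (0 : R).
    apply/cvgrPdist_le => e e0; apply: sU.
    exists (- ln e); split; first exact: num_real.
    move=> t te /=; rewrite sub0r normrN ger0_norm ?gk_ge0//.
    rewrite gk_incl /gromov_product mdistxx -c'0 isoc'// sub0r normrN.
    rewrite -[leRHS](lnK (e0 : e \is Num.pos)) ler_expR.
    by have := ler_norm t; lra.
  exact: (cvg_unique (@Rhausdorff R) h1 h2).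
have [xi xia] := boundary_point bda; exists xi; rewrite xia.
have h1 := lim (fun=> i y') _ (cvg_cst _).
have h2 : (fun t => gk y (i (c' t)) (i y')) @ U --> expR (- mdist y y').
  apply/cvgrPdist_le => e e0; apply: sU.
  exists (mdist y y'); split; first exact: num_real.
  move=> t te /=; rewrite gk_incl /gromov_product.
  have -> : mdist y (c' t) = t.
    rewrite -{1}c'0 isoc'// sub0r normrN ger0_norm//.
    exact: le_trans (mdist_ge0 y y') (ltW te).
  have -> : mdist (c' t) y' = t - mdist y y'.
    by rewrite -{1}c'd isoc'// ger0_norm// subr_ge0 ltW.
  by rewrite [X in `|_ - expR X|](_ : _ = - mdist y y') ?subrr ?normr0 ?ltW//; lra.
exact: (cvg_unique (@Rhausdorff R) (h1 _) h2).
Qed.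

(** The ray from y through x passes x with (y|xi)_x = 0. *)
Lemma opposite_end x y : exists xi, gk x (i y) (v xi) = 1.
Proof.
have [xi xiE] := ray_end y x; exists xi.
have := gk_change y x (i y) (v xi); rewrite !gk_base xiE !mul1r => /eqP.
by rewrite -subr_eq0 -[X in _ - X]mul1r -mulrBl mulf_eq0 subr_eq0
  [expR _ == 0]gt_eqF ?expR_gt0// orbF => /eqP.
Qed.

(** The points a that have an antipode form a closed set, by compactness of the
    boundary, and it contains X by [opposite_end]. *)
Lemma boundary_antipode x a : exists xi, gk x a (v xi) = 1.
Proof.
apply: contrapT => no.
have lt1 xi : gk x a (v xi) < 1.
  by rewrite lt_neqAle gk_le1 andbT; apply/eqP => E; apply: no; exists xi.
have : nbhs a [set b | [set: gp_boundary X] `<=` (fun xi => gk x b (v xi) < 1)].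
  have /compact_near_coveringP := boundary_compact x; apply => xi _.
  have c : continuous (fun q : gp_boundary X * gps_hat X => gk x q.2 (v q.1)).
    apply: gk_comp => q; first exact: cvg_snd.
    apply: (@continuous_comp _ _ _ fst v); first exact: cvg_fst.
    exact: set_val_continuous.
  exact: (cvgr_lt _ (c (xi, a)) _ (lt1 xi)).
rewrite nbhsE => -[V [oV Va] Vb].
have [b [Vb' [y _ yb]]] := @gps_incl_dense R X V (ex_intro _ a Va) oV.
have [xi xiE] := opposite_end x y.
by have := Vb _ Vb' xi I; rewrite -yb xiE ltxx.
Qed.

Lemma boundary_separating x : separating_function (@gp_rho R X x).
Proof.
split=> [|xi eta|xi eta|xi eta].
- apply: gk_comp => q.
    apply: (@continuous_comp _ _ _ fst v); first exact: cvg_fst.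
    exact: set_val_continuous.
  apply: (@continuous_comp _ _ _ snd v); first exact: cvg_snd.
  exact: set_val_continuous.
- exact: gk_ge0.
- exact: gkC.
- exact: gk_boundary.
Qed.

Definition boundary_kernel x : antipodalKernel R :=
  AntipodalKernel (boundary_compact x) (boundary_separating x)
    (fun xi eta => gk_le1 x (v xi) (v eta))
    (fun xi => boundary_antipode x (v xi))
    (projT1 (cid (ray_end x x))).

(** The limit of d(y, z) - d(o, z) as z tends to xi, expressed with the Gromov
    product: d(o, y) - 2 (xi|y)_o. *)
Definition busemann o y xi : R := mdist o y + 2 * ln (gk o (v xi) (i y)).

Lemma gk_busemann0 o y xi :
  gk o (v xi) (i y) = expR ((busemann o y xi - mdist o y) / 2).
Proof.
rewrite /busemann [_ + 2 * _]addrC addrK mulrC mulKf// lnK//.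
exact: gk_point_gt0.
Qed.

Lemma gk_busemann o y y' xi : gk y (v xi) (i y') =
  expR (- (mdist y y' + busemann o y xi - busemann o y' xi) / 2).
Proof.
have := gk_change o y (v xi) (i y').
rewrite gk_incl !(gk_busemann0 o) /gromov_product -!expRD => E.
apply: (mulIf (lt0r_neq0 (expR_gt0 ((busemann o y xi - mdist o y) / 2 +
  - ((mdist o y' + mdist o y - mdist y' y) / 2))))).
rewrite [LHS]E -expRD; congr expR.
by rewrite (metric_sym y y'); lra.
Qed.

Lemma gp_rho_busemann o y xi eta : gp_rho y xi eta =
  expR (- (busemann o y xi + busemann o y eta) / 2) * gp_rho o xi eta.
Proof.
have := gk_change o y (v xi) (v eta); rewrite !gk_busemann0 -!expRD !gp_rhoE => E.
apply: (mulIf (lt0r_neq0 (expR_gt0 ((busemann o y xi - mdist o y) / 2 +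
  (busemann o y eta - mdist o y) / 2)))).
rewrite [LHS]E mulrAC -expRD mulrC.
by congr (_ * _); congr expR; lra.
Qed.

Lemma busemann_base o xi : busemann o o xi = 0.
Proof. by rewrite /busemann mdistxx gkC gk_base ln1 mulr0 addr0. Qed.

Lemma busemann_le o y y' xi : busemann o y xi <= busemann o y' xi + mdist y y'.
Proof.
have := gk_shift o y y' (v xi); rewrite !gk_busemann0 -expRD ler_expR.
by lra.
Qed.

Lemma busemann_lip o y y' xi :
  `|busemann o y xi - busemann o y' xi| <= mdist y y'.
Proof.
have := busemann_le o y y' xi; have := busemann_le o y' y xi.
by rewrite (metric_sym y' y) ler_norml; lra.
Qed.

(** At the end of the ray from y through y'. *)
Lemma busemann_attained o y y' : exists xi,
  busemann o y xi - busemann o y' xi = mdist y y'.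
Proof.
have [xi] := ray_end y y'; rewrite (gk_busemann o) => /expR_inj E.
by exists xi; lra.
Qed.

End GromovKernel.

(** * The embedding by Busemann functions; the tight span as a Gromov product space *)

(** Conversely to [contact], contact points certify extremality. *)
Lemma contact_dual (R : realType) (Z : antipodalKernel R) (f : Z -> R) :
  sup_bounded f -> admissible f ->
  (forall x, exists y, ak_rho x y = expR ((f x + f y) / 2)) ->
  forall x, dual f x = f x.
Proof.
move=> bf af cf x; apply/eqP; rewrite eq_le; apply/andP; split.
  exact: (admissibleP bf).1.
have [y xy] := cf x; have := dual_rho x y bf; rewrite xy ler_expR; lra.
Qed.

(** The factors D cancel in cross-ratios. *)
Lemma twist_moebius (R : realType) (T U : choiceType) (r : T -> T -> R)
    (s : U -> U -> R) (h : T -> U) (D : T -> R) :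
  (forall x, D x != 0) -> (forall x y, s (h x) (h y) = D x * D y * r x y) ->
  moebius_map r s h.
Proof.
move=> D0 E x x' y y' _; rewrite /cross_ratio !E.
have K0 : D x * D x' * D y * D y' != 0 by rewrite !mulf_neq0.
rewrite -[RHS]mul1r -{1}(divff K0) mulf_div; congr (_ / _); ring.
Qed.

(** A closed set A has closed preimage w^-1 (g A) under h. *)
Lemma compact_factor_continuous (T U V : topologicalType) (g : T -> V)
    (h : U -> T) (w : U -> V) : compact [set: T] -> hausdorff_space V ->
  continuous g -> injective g -> continuous w -> (forall u, g (h u) = w u) ->
  continuous h.
Proof.
move=> cT hV cg ig cw gh; apply/continuous_closedP => A cA.
have -> : h @^-1` A = w @^-1` (g @` A).
  apply/seteqP; split=> [u Au|u [t At]]; first by exists (h u).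
  by rewrite -gh => /ig tu; rewrite /preimage/= -tu.
apply: preimage_closed => [u _|]; first exact: cw.
apply: compact_closed => //; apply: continuous_compact.
  exact: continuous_subspaceT.
exact: (subclosed_compact cA cT).
Qed.

Section Visual.
Context {R : realType} {X : gromovProductSpace R}.
Implicit Types (o x y : X) (xi eta : gp_boundary X).

Local Notation i := (@gps_incl R X).
Local Notation v := (@gp_boundary_val R X).

Lemma busemann_bounded o y xi : `|busemann o y xi| <= mdist o y.
Proof.
by have := busemann_lip o y o xi; rewrite busemann_base subr0 metric_sym.
Qed.

Lemma busemann_sup_bounded o y :
  @sup_bounded R (boundary_kernel o) (busemann o y).
Proof. by exists (mdist o y) => xi; exact: busemann_bounded. Qed.

Lemma busemann_admissible o y : @admissible R (boundary_kernel o) (busemann o y).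
Proof.
move=> xi eta /=; have := gk_le1 y (v xi) (v eta).
rewrite -gp_rhoE (gp_rho_busemann o) mulNr expRN.
by rewrite ler_pdivrMl ?expR_gt0// mulr1.
Qed.

(** The points in contact are the antipodal pairs for [gp_rho y]. *)
Lemma busemann_dual o y xi :
  @dual R (boundary_kernel o) (busemann o y) xi = busemann o y xi.
Proof.
apply: contact_dual; [exact: busemann_sup_bounded|exact: busemann_admissible|].
move=> {}xi; have [eta] := boundary_antipode y (v xi).
rewrite -gp_rhoE (gp_rho_busemann o) mulNr expRN => E; exists eta => /=.
by apply: (mulfI (lt0r_neq0 (expR_gt0 (- ((busemann o y xi + busemann o y eta) / 2)))));
  rewrite expRN E mulVf// gt_eqF ?expR_gt0.
Qed.

Definition visual o y : tightSpan (boundary_kernel o) :=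
  TightSpan (busemann_sup_bounded o y) (busemann_dual o y).

Lemma visual_isometric o y y' : mdist (visual o y) (visual o y') = mdist y y'.
Proof.
apply/eqP; rewrite eq_le; apply/andP; split.
  by apply: ts_lub => xi; exact: busemann_lip.
have [xi <-] := busemann_attained o y y'.
exact: le_trans (ler_norm _) (ts_ub (visual o y) (visual o y') xi).
Qed.

End Visual.

Section TightSpanGromov.
Context {R : realType} (Z : antipodalKernel R).
Implicit Types (p f g : tightSpan Z) (a b : tsHat Z).

Local Notation In := (@HatIn R Z).
Local Notation Bd := (@HatBd R Z).

Definition ts_product p a b : \bar R := mlog (hker p a b).

Lemma ts_product_ge0 p a b : (0 <= ts_product p a b)%E.
Proof. exact/mlog_ge0/hker_le1. Qed.

Lemma ts_product_continuous p :
  continuous (fun q : tsHat Z * tsHat Z => ts_product p q.1 q.2).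
Proof.
move=> q; apply: (@continuous_comp _ _ _ (fun q => hker p q.1 q.2) (@mlog R)).
  exact: hker_continuous.
exact: mlog_continuous.
Qed.

Lemma ts_product_incl p f g :
  ts_product p (In f) (In g) = (gromov_product p f g)%:E.
Proof. by rewrite /ts_product mlog_expR /gromov_product; congr EFin; lra. Qed.

Lemma outside_In a : (~` range In) a -> exists x, a = Bd x.
Proof. by case: a => [f []|x _]; [exists f|exists x]. Qed.

Lemma ts_product_boundary p a b : (~` range In) a -> (~` range In) b ->
  ts_product p a b = +oo%E <-> a = b.
Proof.
move=> /outside_In[x ->] /outside_In[y ->]; rewrite mlog_eqy /=.
rewrite pmulr_rle0 ?expR_gt0//; split=> [xy|[->]]; last by rewrite ak_rhoxx.
by congr HatBd; apply/ak_rho_eq0/eqP; rewrite eq_le xy ak_rho_ge0.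
Qed.

Definition tight_span_gps : gromovProductSpace R :=
  GromovProductSpace (@ts_proper R Z) (injective_geodesic (@tight_span_injective R Z))
    (@ts_complete R Z) (@hat_compact R Z) (@metric_hausdorff R (tsHat Z))
    (@hat_second_countable R Z) (@In_embedding R Z) (@In_dense R Z)
    ts_product_ge0 ts_product_continuous ts_product_incl ts_product_boundary.

Local Notation Y := tight_span_gps.

Lemma ts_gkE (p : Y) (a b : gps_hat Y) : gk p a b = hker p a b.
Proof. by rewrite /gk /= mlogK// hker_ge0. Qed.

Lemma Bd_outside (x : Z) : (~` range (@gps_incl R Y)) (Bd x).
Proof. by move=> [f _]. Qed.

(** Z is compact and its image is the whole boundary, so the inverse of this map
    is a homeomorphism. *)
Definition ts_end (x : Z) : gp_boundary Y :=
  exist _ (Bd x : gps_hat Y) (mem_set (@Bd_outside x)).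

Lemma ts_end_val x : gp_boundary_val (ts_end x) = Bd x.
Proof. by rewrite /gp_boundary_val set_valE. Qed.

Lemma ts_end_homeomorphism :
  exists h : gp_boundary Y -> Z,
    homeomorphism h /\ forall xi, gp_boundary_val xi = Bd (h xi).
Proof.
have /choice[h hP] (xi : gp_boundary Y) : exists x, gp_boundary_val xi = Bd x.
  by apply: outside_In; exact: set_valP.
have endK : cancel ts_end h.
  by move=> x; have := hP (ts_end x); rewrite ts_end_val => -[].
have hK : cancel h ts_end.
  by move=> xi; apply: val_inj; exact: (esym (hP xi)).
have Bd_inj : injective Bd by move=> x y [].
exists h; split=> //; split.
  apply: (compact_factor_continuous (g := Bd) (w := @gp_boundary_val R Y)) => //.
  - exact: ak_compact.
  - exact: (@metric_hausdorff R (tsHat Z)).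
  - exact: Bd_continuous.
  - exact: set_val_continuous.
exists ts_end; split=> // x; apply: set_type_cvg; exact: Bd_continuous.
Qed.

End TightSpanGromov.

(** * Maximal spaces are injective *)

Lemma injective_transfer (R : realType) (V W : metricType R) (h : V -> W) :
  (forall x y, mdist (h x) (h y) = mdist x y) -> (forall w, exists x, h x = w) ->
  injective_metric_space W -> injective_metric_space V.
Proof.
move=> hiso /choice[k hk] injW B A F Flip.
have [|g [glip gF]] := injW B A (h \o F); first by move=> a b; rewrite /= hiso.
exists (k \o g); split=> [x y|a] /=; first by rewrite -hiso !hk.
by apply: mdist_positivity; rewrite -hiso hk gF mdistxx.
Qed.

Lemma compact_sup_bounded (R : realType) (T : topologicalType) (u : T -> R) :
  compact [set: T] -> continuous u -> exists M, forall t, `|u t| <= M.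
Proof.
move=> cT cu; have : compact (range u).
  by apply: continuous_compact => //; exact: continuous_subspaceT.
move=> /compact_bounded [M [_ /(_ (M + 1))]].
by rewrite ltrDl ltr01 => /(_ isT) h; exists (M + 1) => t; apply: h; exists t.
Qed.

(** If the preimage of P is not a neighbourhood of t, its complement
    belongs to some ultrafilter that converges to t. *)
Lemma continuous_ultra (T U : topologicalType) (h : T -> U) (t : T) :
  (forall F : set_system T, UltraFilter F -> F --> t -> h @ F --> h t) ->
  {for t, continuous h}.
Proof.
move=> hF P Pht; apply: contrapT => nP.
pose G := within (~` (h @^-1` P)) (nbhs t).
have PG : ProperFilter G.
  apply: Build_ProperFilter_ex => Q GQ; apply: contrapT => noQ.
  apply: nP; change (nbhs t (h @^-1` P)).
  apply: (filterS _ (GQ : nbhs t _)) => s Qs; apply: contrapT => Ps; apply: noQ.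
  by exists s; exact: Qs.
have [F [UF GF]] := ultraFilterLemma PG.
have PF := @ultra_proper _ F UF.
have Ft : F --> t by move=> Q /= tQ; apply: GF; exact: filterS tQ.
have FP : F (h @^-1` P) := hF F UF Ft P Pht.
have FnP : F (~` (h @^-1` P)) by apply: GF; apply: filterS (@filterT _ (nbhs t) _) => s _.
by have [s []] := filter_ex (filterI FP FnP).
Qed.

Section HatFilters.
Context {R : realType} {X : gromovProductSpace R}.
Local Notation i := (@gps_incl R X).
Local Notation v := (@gp_boundary_val R X).

Lemma hat_ultra (a : gps_hat X) :
  exists F : set_system X, UltraFilter F /\ i @ F --> a.
Proof.
pose G := filter_from (nbhs a) (fun B => i @^-1` B).
have PG : ProperFilter G.
  apply: filter_from_proper; first apply: filter_from_filter.
  - by exists setT; exact: filterT.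
  - move=> A B nA nB; exists (A `&` B); first exact: filterI.
    by move=> x [].
  - move=> A; rewrite nbhsE => -[V [oV Va] VA].
    have [b [Vb [x _ xb]]] := @gps_incl_dense R X V (ex_intro _ a Va) oV.
    by exists x; apply: VA; rewrite xb.
have [F [UF GF]] := ultraFilterLemma PG; exists F; split=> //.
by move=> A nA; apply: GF; exists A.
Qed.

Lemma hat_cases (a : gps_hat X) : (exists x, a = i x) \/ (exists xi, a = v xi).
Proof.
have [[x _ xa]|na] := pselect (range i a); first by left; exists x.
by right; have [xi xia] := boundary_point na; exists xi.
Qed.

Lemma incl_boundary x xi : i x <> v xi.
Proof.
move=> E; have : (~` range i) (v xi) by exact: set_valP.
by apply; exists x.
Qed.

Lemma incl_inj : injective i.
Proof. by have [] := @gps_incl_embedding R X. Qed.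

End HatFilters.

Section MaximalInjective.
Context {R : realType} {X : gromovProductSpace R}.
Hypothesis Z4 : at_least_four_points (gp_boundary X).
Implicit Types (o x y : X) (xi eta : gp_boundary X).

Local Notation i := (@gps_incl R X).
Local Notation v := (@gp_boundary_val R X).

(** With three distinct points, the three pair sums determine the values. *)
Lemma pair_sums_eq (f g : gp_boundary X -> R) :
  (forall xi eta, xi != eta -> f xi + f eta = g xi + g eta) -> f =1 g.
Proof.
move=> fg xi; have [eta [ne _]] := avoid_two Z4 xi xi.
have [zeta [n1 n2]] := avoid_two Z4 xi eta.
have := fg _ _ ne; have := fg _ _ n1; have := fg _ _ n2; lra.
Qed.

(** Gromov products are preserved on Y, which is dense. *)
Lemma gromov_isometry_kernel (Y : gromovProductSpace R) (F : Y -> X)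
    (Fhat : gps_hat Y -> gps_hat X) :
  (forall y y' : Y, mdist (F y) (F y') = mdist y y') ->
  (forall y : Y, Fhat (gps_incl y) = gps_incl (F y)) -> continuous Fhat ->
  forall (y : Y) a b, gk (F y) (Fhat a) (Fhat b) = gk y a b.
Proof.
move=> Fiso FE cF y a b.
apply: (@hat_dense2 _ Y (fun q => gk (F y) (Fhat q.1) (Fhat q.2))
  (fun q => gk y q.1 q.2) _ _ _ (a, b)).
- apply: gk_comp => q.
    by apply: (@continuous_comp _ _ _ fst Fhat); [exact: cvg_fst|exact: cF].
  by apply: (@continuous_comp _ _ _ snd Fhat); [exact: cvg_snd|exact: cF].
- exact: gk_continuous.
- by move=> z w /=; rewrite !FE !gk_incl /gromov_product !Fiso.
Qed.

(** Apply maximality to the tight span, with the identification h of its boundary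
    with that of X.  The resulting map F preserves Gromov products, so that the
    kernels of the boundary seen from e and from F e agree; the sums over pairs of
    e and of the Busemann function of F e are then equal. *)
Lemma maximal_visual_onto o : maximal_gromov_product_space X ->
  forall e : tightSpan (boundary_kernel o), exists x, visual o x = e.
Proof.
move=> maxX e; pose K := boundary_kernel o.
have [h [hh hE]] := ts_end_homeomorphism K.
have mh : @moebius_homeomorphism R (tight_span_gps K) X h.
  split=> // f x.
  pose D (xi : gp_boundary (tight_span_gps K)) :=
    expR (f (h xi) / 2 - busemann o x (h xi) / 2).
  apply: (@twist_moebius _ _ _ _ _ _ D) => [xi|xi eta].
    by rewrite gt_eqF ?expR_gt0.
  rewrite (gp_rho_busemann o) (gp_rhoE f) ts_gkE !hE /= mulrA -!expRD.
  by congr (expR _ * _); lra.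
have [F [Fhat [Fiso FE Fbd cF]]] := maxX _ h mh.
have [_ [k [_ _ kK]]] := hh.
exists (F e); apply: ts_eq; apply: pair_sums_eq => xi eta ne.
have := gromov_isometry_kernel Fiso FE cF e
  (gp_boundary_val (k xi)) (gp_boundary_val (k eta)).
rewrite !Fbd !kK ts_gkE !hE !kK -gp_rhoE (gp_rho_busemann o) /=.
have r0 : gp_rho o xi eta != 0 by rewrite gt_eqF// (separating_gt0 (boundary_separating o)).
by move=> /(mulIf r0)/expR_inj; lra.
Qed.

Lemma maximal_injective : maximal_gromov_product_space X ->
  injective_metric_space X.
Proof.
move=> maxX; have [xi _] := Z4; have [x0 _] := gps_inhabited (v xi).
apply: (injective_transfer (@visual_isometric _ _ x0)).
  exact: maximal_visual_onto.
exact: tight_span_injective.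
Qed.

End MaximalInjective.

(** * Injective spaces are maximal *)

Lemma log_continuous (R : realType) (T : topologicalType) (D : T -> R) :
  (forall t, 0 < D t) -> continuous D -> continuous (fun t => - ln (D t)).
Proof.
move=> D0 cD t; apply: cvgN; apply: continuous_comp; first exact: cD.
exact: continuous_ln.
Qed.

Lemma expR_half_continuous (R : realType) (T : topologicalType) (u : T -> R) c :
  continuous u -> continuous (fun t => expR ((u t - c) / 2)).
Proof.
move=> cu t; apply: continuous_comp; last exact: continuous_expR.
by apply: cvgM; [apply: cvgB; [exact: cu|exact: cvg_cst]|exact: cvg_cst].
Qed.

Section InjectiveMaximal.
Context {R : realType} {X : gromovProductSpace R}.
Hypothesis injX : injective_metric_space X.
Implicit Types (o x y : X) (xi eta : gp_boundary X).

Local Notation i := (@gps_incl R X).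
Local Notation v := (@gp_boundary_val R X).

(** r extends the inverse of [visual o]. *)
Lemma injective_retraction (o : X) : exists r : tightSpan (boundary_kernel o) -> X,
  forall e y, mdist (r e) y <= mdist e (visual o y).
Proof.
pose A := range (visual o).
have /choice[k kP] (a : set_type A) : exists y, visual o y = set_val a.
  by have [y _ ya] : A (set_val a) := set_valP a; exists y.
have [|r [rlip rE]] := injX (A := A) (f := k).
  by move=> a b; rewrite -(visual_isometric o) !kP.
exists r => e y.
have Ay : visual o y \in A by apply/mem_set; exists y.
have ry := rE (exist _ (visual o y) Ay).
rewrite set_valE /= in ry.
have <- : r (visual o y) = y.
  rewrite ry; apply: mdist_positivity.
  by rewrite -(visual_isometric o) kP set_valE /= mdistxx.
by have := rlip e (visual o y); rewrite ry; rewrite kP set_valE.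
Qed.

(** [dual] reverses the order, so a function below an extremal one has a dual
    above it. *)
Lemma visual_minimal o (e : tightSpan (boundary_kernel o)) x :
  (forall xi, busemann o x xi <= e xi) -> visual o x = e.
Proof.
move=> le; apply: ts_eq => xi; apply/eqP; rewrite eq_le le /=.
have : dual e xi <= dual (visual o x) xi + 0.
  apply: dual_le_shift; [exact: ts_bounded|exact: ts_bounded|].
  by move=> eta /=; rewrite addr0.
by rewrite !ts_dual addr0.
Qed.

(** Let y tend to xi.  The distance of e and [visual o y] is attained at some
    z y, so that d(x, y) <= e (z y) - busemann o y (z y) <= e (z y) + d(o, y).
    The first inequality forces the Gromov product (z y|y)_o to tend to infinity,
    hence z y to tend to xi; the second then gives
    lim (d(x, y) - d(o, y)) <= e xi, and the left side is [busemann o x xi]. *)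
Lemma dominated_busemann o (e : tightSpan (boundary_kernel o)) x :
  (forall y, mdist x y <= mdist e (visual o y)) ->
  forall xi, busemann o x xi <= e xi.
Proof.
move=> le xi; have /choice[z zP] y : exists zeta : boundary_kernel o,
    mdist x y <= e zeta - busemann o y zeta.
  have [zeta [_ [E _ _ _]]] := dist_contact e (visual o y).
  by exists zeta; rewrite [leRHS]E le.
have [M eM] := ts_bounded e.
have [F [UF iF]] := hat_ultra (v xi); have PF := @ultra_proper _ F UF.
have [zeta _ zF] := ultra_compact_cvg (h := z) (@ak_compact R (boundary_kernel o)) UF filterT.
have vzF : (v \o z) @ F --> v zeta.
  by apply: continuous_cvg zF; exact: set_val_continuous.
have zxi : zeta = xi.
  apply/(gk_boundary o)/eqP; rewrite eq_le gk_ge0 andbT.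
  pose C := expR ((M + mdist o x) / 2).
  have h1 : (fun y => gk o (v (z y)) (i y)) @ F --> gk o (v zeta) (v xi).
    apply: (cvg_comp (fun y => (v (z y), i y)) (fun q => gk o q.1 q.2)).
      exact: (cvg_pair vzF iF).
    exact: (@gk_continuous _ _ o (v zeta, v xi)).
  have h2 : (fun y => C * gk o (i y) (i y)) @ F --> C * gk o (v xi) (v xi).
    apply: cvgM; first exact: cvg_cst.
    apply: (cvg_comp (fun y => (i y, i y)) (fun q => gk o q.1 q.2)).
      exact: (cvg_pair iF iF).
    exact: (@gk_continuous _ _ o (v xi, v xi)).
  have -> : 0 = C * gk o (v xi) (v xi).
    by rewrite (gk_boundary o xi xi).2// mulr0.
  apply: (ler_cvg_to h1 h2); apply: nearW => y.
  rewrite gk_busemann0 gk_incl /gromov_product mdistxx -expRD ler_expR.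
  have := zP y; have := eM (z y); have := metric_triangle o x y.
  by rewrite ler_norml; lra.
have h1 : (fun y => gk o (i y) (i x)) @ F --> gk o (v xi) (i x).
  apply: (cvg_comp i (gk o ^~ (i x))); first exact: iF.
  exact: gk_continuousl.
have h2 : (fun y => expR ((e (z y) - mdist o x) / 2)) @ F -->
    expR ((e xi - mdist o x) / 2).
  have c2 := expR_half_continuous (c := mdist o x) (@ts_continuous _ _ e).
  by rewrite -zxi; exact: (cvg_comp z _ zF (c2 zeta)).
have : gk o (v xi) (i x) <= expR ((e xi - mdist o x) / 2).
  apply: (ler_cvg_to h1 h2); apply: nearW => y.
  rewrite gk_incl ler_expR /gromov_product.
  have := zP y; have := busemann_bounded o y (z y).
  by rewrite (metric_sym y x) ler_norml; lra.
by rewrite gk_busemann0 ler_expR; lra.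
Qed.

Lemma injective_visual_onto o (e : tightSpan (boundary_kernel o)) :
  exists x, visual o x = e.
Proof.
have [r rP] := injective_retraction o; exists (r e).
by apply: visual_minimal; apply: dominated_busemann => y; exact: rP.
Qed.

End InjectiveMaximal.

(** Let an ultrafilter converge to a and its image to b.  The assumption
    gives the Gromov products of b with the image of the compactification and
    with itself.  They determine b: at infinity
    because (b|Fhat a) = +oo, and in X because (b|b) is a distance. *)
Lemma kernel_isometry_extends (R : realType) (X Y : gromovProductSpace R)
    (F : Y -> X) (Fhat : gps_hat Y -> gps_hat X) :
  (forall y : Y, Fhat (gps_incl y) = gps_incl (F y)) ->
  (forall (y : Y) a b, gk (F y) (Fhat a) (Fhat b) = gk y a b) ->
  continuous Fhat.
Proof.
move=> FE Fk a; apply: continuous_ultra => U UU Ua.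
have PU := @ultra_proper _ U UU.
have [b _ Fb] := ultra_compact_cvg (h := Fhat) (@gps_hat_compact R X) UU filterT.
suff -> : Fhat a = b by [].
have lim y c c' (w : gps_hat Y -> gps_hat Y) : w @ U --> c ->
    (Fhat \o w) @ U --> c' -> gk (F y) b c' = gk y a c.
  move=> wc wc'.
  have h1 : (fun t => gk (F y) (Fhat t) (Fhat (w t))) @ U --> gk (F y) b c'.
    apply: (cvg_comp (fun t => (Fhat t, Fhat (w t))) (fun q => gk (F y) q.1 q.2)).
      exact: (cvg_pair Fb wc').
    exact: (@gk_continuous _ _ (F y) (b, c')).
  have h2 : (fun t => gk (F y) (Fhat t) (Fhat (w t))) @ U --> gk y a c.
    have -> : (fun t => gk (F y) (Fhat t) (Fhat (w t))) = fun t => gk y t (w t).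
      by apply/funext => t; exact: Fk.
    apply: (cvg_comp (fun t => (t, w t)) (fun q => gk y q.1 q.2)).
      exact: (cvg_pair Ua wc).
    exact: (@gk_continuous _ _ y (a, c)).
  exact: (cvg_unique (@Rhausdorff R) h1 h2).
have diag y : gk (F y) b b = gk y a a by apply: (lim y a b id).
have [[y ya]|[xi xia]] := hat_cases a.
  have := diag y; rewrite ya gk_base FE.
  have [[x ->]|[eta ->]] := hat_cases b.
    rewrite gk_incl /gromov_product mdistxx => E.
    congr gps_incl; apply: mdist_positivity.
    by move: E; rewrite -[RHS]expR0 => /expR_inj; lra.
  by rewrite (gk_boundary _ _ _).2// => /eqP; rewrite eq_sym oner_eq0.
have [y0 _] := gps_inhabited a.
have a0 : gk y0 a a = 0 by rewrite xia; exact/gk_boundary.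
have [eta beta] : exists eta, gp_boundary_val eta = b.
  by apply: boundary_point; apply/(gk_diag (F y0)); rewrite diag.
have [zeta zetaE] : exists zeta, gp_boundary_val zeta = Fhat a.
  by apply: boundary_point; apply/(gk_diag (F y0)); rewrite Fk.
rewrite -zetaE -beta; congr gp_boundary_val; apply/esym/(gk_boundary (F y0)).
rewrite beta zetaE -a0; apply: (lim y0 a (Fhat a) (fun=> a)); exact: cvg_cst.
Qed.

Section Extension.
Context {R : realType} {X Y : gromovProductSpace R}.
Hypothesis injX : injective_metric_space X.
Hypothesis Z4 : at_least_four_points (gp_boundary X).
Variable f : gp_boundary Y -> gp_boundary X.
Hypothesis mf : moebius_homeomorphism f.

(** Transported by the inverse of f, [gp_rho y0] is a function on the boundary of
    X that is Moebius equivalent to [gp_rho o]; e0 is minus the logarithm of the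
    derivative. *)
Lemma moebius_comparison (o : X) (y0 : Y) : exists e0 : gp_boundary X -> R,
  (exists M, forall xi, `|e0 xi| <= M) /\
  forall xi eta, gp_rho y0 xi eta =
    expR (- (e0 (f xi) + e0 (f eta)) / 2) * gp_rho o (f xi) (f eta).
Proof.
have [[cf [g [cg fg gf]]] fm] := mf.
pose r xi eta := gp_rho y0 (g xi) (g eta).
have [c0 ge0 rC r0] := boundary_separating y0.
have sr : separating_function r.
  split=> [|xi eta|xi eta|xi eta]; [|exact: ge0|exact: rC|].
    have cvg : continuous (fun xi => gp_boundary_val (g xi)).
      by move=> xi; apply: continuous_comp; [exact: cg|exact: set_val_continuous].
    apply: gk_comp => q.
      apply: (@continuous_comp _ _ _ fst (fun xi => gp_boundary_val (g xi))).
        exact: cvg_fst.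
      exact: cvg.
    apply: (@continuous_comp _ _ _ snd (fun xi => gp_boundary_val (g xi))).
      exact: cvg_snd.
    exact: cvg.
  by split=> [/r0/(can_inj gf)//|->]; exact/r0.
have so := boundary_separating o.
have me : moebius_equivalent (gp_rho o) r.
  move=> x x' y y' u; have := fm y0 o (g x) (g x') (g y) (g y').
  rewrite !gf; apply.
  have : uniq (map g [:: x; x'; y; y']) by rewrite map_inj_uniq//; exact: can_inj gf.
  by [].
have [D [D0 cD DE]] := is_derivative_exists Z4 so sr me.
exists (fun xi => - ln (D xi)); split.
  apply: compact_sup_bounded; first exact: (boundary_compact o).
  exact: log_continuous D0 cD.
move=> xi eta.
have -> : gp_rho y0 xi eta = r (f xi) (f eta) by rewrite /r !fg.
have [_ o0 _ _] := so; have [_ rr0 _ _] := sr.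
apply/eqP; rewrite -(@eqrXn2 _ 2)// ?mulr_ge0 ?expR_ge0//; apply/eqP.
rewrite DE exprMn; congr (_ * _).
rewrite expr2 -expRD -{1}(lnK (D0 (f xi) : _ \is Num.pos)).
rewrite -{1}(lnK (D0 (f eta) : _ \is Num.pos)) -expRD; congr expR; lra.
Qed.

(** F y is the point of X whose Busemann function is that of y, transported by f
    and corrected by [e0] for the change from [gp_rho y0] to [gp_rho o].  The
    correction cancels in differences, so F preserves distances and Gromov
    products with the boundary. *)
Lemma moebius_extends : exists (F : Y -> X) (Fhat : gps_hat Y -> gps_hat X),
  [/\ forall y y' : Y, mdist (F y) (F y') = mdist y y',
      forall y : Y, Fhat (gps_incl y) = gps_incl (F y),
      forall xi : gp_boundary Y,
        Fhat (gp_boundary_val xi) = gp_boundary_val (f xi)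
    & continuous Fhat].
Proof.
have [[cf [g [cg fg gf]]] fm] := mf.
have [pt _] := Z4.
have [x0 _] := gps_inhabited (gp_boundary_val pt).
have [y0 _] := gps_inhabited (gp_boundary_val (g pt)).
pose K := boundary_kernel x0.
have [e0 [[M e0M] e0E]] := moebius_comparison x0 y0.
pose e (y : Y) (xi : K) : R := e0 xi + busemann y0 y (g xi).
have eE (y : Y) xi eta : gp_rho y (g xi) (g eta) =
    expR (- (e y xi + e y eta) / 2) * gp_rho x0 xi eta.
  rewrite (gp_rho_busemann y0) e0E !gf mulrA -expRD; congr (expR _ * _).
  by rewrite /e; lra.
have eb y : sup_bounded (e y).
  exists (M + mdist y0 y) => xi; rewrite /e (le_trans (ler_normD _ _))//.
  by rewrite lerD// busemann_bounded.
have ea y : admissible (e y).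
  move=> xi eta; have := gk_le1 y (gp_boundary_val (g xi)) (gp_boundary_val (g eta)).
  by rewrite -gp_rhoE eE mulNr expRN ler_pdivrMl ?expR_gt0// mulr1.
have ed y : forall xi, dual (e y) xi = e y xi.
  apply: contact_dual => // xi.
  have [eta] := boundary_antipode y (gp_boundary_val (g xi)).
  rewrite -gp_rhoE -(fg eta) eE => E; exists (f eta).
  apply: (mulfI (lt0r_neq0 (expR_gt0 (- (e y xi + e y (f eta)) / 2)))).
  by rewrite [LHS]E -expRD -[LHS]expR0; congr expR; lra.
pose E y : tightSpan K := TightSpan (eb y) (ed y).
have /choice[F FE] y := injective_visual_onto injX (E y).
have bE y xi : busemann x0 (F y) xi = e y xi by rewrite -[RHS]/(E y xi) -FE.
have Fiso y y' : mdist (F y) (F y') = mdist y y'.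
  rewrite -(visual_isometric x0) !FE; apply/eqP; rewrite eq_le; apply/andP; split.
    apply: ts_lub => xi /=; rewrite /e opprD addrACA subrr add0r.
    exact: busemann_lip.
  have [eta etaE] := busemann_attained y0 y y'.
  apply: le_trans (ts_ub (E y) (E y') (f eta)).
  rewrite /= /e fg opprD addrACA subrr add0r etaE; exact: ler_norm.
have /choice[Fhat FhatE] (a : gps_hat Y) : exists b : gps_hat X,
    (forall y : Y, a = gps_incl y -> b = gps_incl (F y)) /\
    (forall xi : gp_boundary Y, a = gp_boundary_val xi -> b = gp_boundary_val (f xi)).
  have [[y ->]|[xi ->]] := hat_cases a.
    exists (gps_incl (F y)); split=> [y' /incl_inj->//|xi /incl_boundary//].
  exists (gp_boundary_val (f xi)); split=> [y /esym/incl_boundary//|eta /val_inj->//].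
have Fi (y : Y) : Fhat (gps_incl y) = gps_incl (F y) by exact: (FhatE _).1.
have Fv xi : Fhat (gp_boundary_val xi) = gp_boundary_val (f xi) by exact: (FhatE _).2.
exists F, Fhat; split=> //; apply: (kernel_isometry_extends Fi) => y a b.
have mixed xi y' : gk (F y) (gp_boundary_val (f xi)) (gps_incl (F y')) =
    gk y (gp_boundary_val xi) (gps_incl y').
  rewrite (gk_busemann x0) (gk_busemann y0) !bE Fiso /e fg; congr expR; lra.
have [[u ->]|[xi ->]] := hat_cases a; have [[w ->]|[eta ->]] := hat_cases b;
  rewrite ?Fi ?Fv.
- by rewrite !gk_incl /gromov_product !Fiso.
- by rewrite gkC mixed gkC.
- exact: mixed.
- by rewrite -!gp_rhoE (gp_rho_busemann x0) !bE -eE !fg.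
Qed.

End Extension.

(** * The Moebius space is a tight span *)

Section MoebiusSpace.
Context {R : realType} (Z : antipodalSpace R).

Let rho0 := @antipodal_rho R Z.

Lemma antipodal_le1 (rho : Z -> Z -> R) x y : antipodal_function rho -> rho x y <= 1.
Proof.
move=> [_ s1 _]; rewrite -s1; apply: ub_le_sup; last by exists (x, y).
have [//|ns] := pselect (has_sup (range (fun p : Z * Z => rho p.1 p.2))).
  by case.
by move: s1; rewrite (sup_out ns) => /eqP; rewrite eq_sym oner_eq0.
Qed.

Lemma rho0_separating : separating_function rho0.
Proof. by have [] := @antipodal_rhoP R Z. Qed.

Lemma rho0_antipode x : exists y, rho0 x y = 1.
Proof. by have [] := @antipodal_rhoP R Z. Qed.

Definition space_kernel : antipodalKernel R :=
  AntipodalKernel (@antipodal_compact R Z) rho0_separating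
    (fun x y => antipodal_le1 x y (@antipodal_rhoP R Z)) rho0_antipode
    (projT1 (cid (@antipodal_four_points R Z))).

Definition moebius_base : moebius_space Z :=
  MoebiusSpace (@antipodal_rhoP R Z) (fun _ _ _ _ _ => erefl).

(** The extremal function that corresponds to [r]; the sign makes it behave like
    a distance to the boundary points. *)
Definition log_derivative (r : moebius_space Z) (z : space_kernel) : R :=
  - ln (derivative moebius_base r z).

Lemma log_derivativeE (r : moebius_space Z) x y :
  r x y = expR (- (log_derivative r x + log_derivative r y) / 2) * rho0 x y.
Proof.
have [D0 _ DE] := moebius_derivativeP moebius_base r.
have [[_ r0 _ _] _ _] := moebius_rho_antipodal r.
have [_ p0 _ _] := rho0_separating.
apply/eqP; rewrite -(@eqrXn2 _ 2)// ?mulr_ge0 ?expR_ge0//; apply/eqP.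
rewrite DE exprMn; congr (_ * _); rewrite expr2 -expRD.
rewrite -{1}(lnK (D0 x : _ \is Num.pos)) -{1}(lnK (D0 y : _ \is Num.pos)) -expRD.
by congr expR; rewrite /log_derivative; lra.
Qed.

Lemma log_derivative_bounded r : sup_bounded (log_derivative r).
Proof.
exists (mdist moebius_base r) => z; rewrite /log_derivative normrN.
exact: moebius_dist_ub.
Qed.

Lemma log_derivative_dual r z : dual (log_derivative r) z = log_derivative r z.
Proof.
apply: contact_dual; first exact: log_derivative_bounded.
  move=> x y; have := antipodal_le1 x y (moebius_rho_antipodal r).
  by rewrite log_derivativeE mulNr expRN ler_pdivrMl ?expR_gt0// mulr1.
move=> x; have [_ _ /(_ x)[y]] := moebius_rho_antipodal r.
rewrite log_derivativeE => E; exists y.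
apply: (mulfI (lt0r_neq0 (expR_gt0 (- (log_derivative r x + log_derivative r y) / 2)))).
by rewrite [LHS]E -expRD -[LHS]expR0; congr expR; lra.
Qed.

Definition moebius_to_span (r : moebius_space Z) : tightSpan space_kernel :=
  TightSpan (log_derivative_bounded r) (log_derivative_dual r).

(** By the chain rule the derivative of s with respect to r is the quotient of
    their derivatives with respect to the base point. *)
Lemma moebius_to_span_isometric r s :
  mdist (moebius_to_span r) (moebius_to_span s) = mdist r s.
Proof.
have [Dr0 cr Er] := moebius_derivativeP moebius_base r.
have [Ds0 cs Es] := moebius_derivativeP moebius_base s.
pose Dr := derivative moebius_base r; pose Ds := derivative moebius_base s.
have E : derivative r s = fun z => Ds z / Dr z.
  apply: moebius_derivativeE; split=> [x|x|x y].
  - by rewrite divr_gt0// ?Dr0 ?Ds0.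
  - by apply: cvgM; [exact: cs|apply: cvgV; [rewrite gt_eqF|exact: cr]].
  - rewrite Es Er -/Dr -/Ds; have := lt0r_neq0 (Dr0 x); have := lt0r_neq0 (Dr0 y).
    by rewrite -/Dr => *; field; do ?[apply/andP; split].
rewrite [LHS]/(sup _) [RHS]/(sup _).
congr sup; apply: eq_imagel => z _ /=.
by rewrite E lnM ?posrE ?invr_gt0// lnV ?posrE// /log_derivative -/Dr -/Ds opprK addrC.
Qed.

Lemma moebius_to_span_onto (f : tightSpan space_kernel) :
  exists r, moebius_to_span r = f.
Proof.
pose D (z : Z) := expR (- f z / 2).
pose r (x y : Z) := D x * D y * rho0 x y.
have DE x y : D x * D y = expR (- (f x + f y) / 2).
  by rewrite -expRD; congr expR; lra.
have cD : continuous D.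
  move=> z; apply: continuous_comp; last exact: continuous_expR.
  by apply: cvgM; [apply: cvgN; exact: ts_continuous|exact: cvg_cst].
have D0 z : 0 < D z by exact: expR_gt0.
have [c0 p0 pC pE] := rho0_separating.
have le1 x y : r x y <= 1.
  have := ts_rho f x y; rewrite /r DE mulNr expRN.
  by rewrite ler_pdivrMl ?expR_gt0// mulr1.
have anti x : exists y, r x y = 1.
  have [y xy] := contact f x; exists y.
  by rewrite /r DE [rho0 x y]xy -expRD -[RHS]expR0; congr expR; lra.
have sr : separating_function r.
  split=> [|x y|x y|x y].
  - move=> q; apply: cvgM; last exact: c0.
    apply: cvgM.
      by apply: (@continuous_comp _ _ _ fst D); [exact: cvg_fst|exact: cD].
    by apply: (@continuous_comp _ _ _ snd D); [exact: cvg_snd|exact: cD].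
  - by rewrite mulr_ge0// mulr_ge0// ltW.
  - by rewrite /r (mulrC (D x)) pC.
  - split=> [/eqP|/pE xy]; last by rewrite /r xy mulr0.
    by rewrite mulf_eq0 gt_eqF ?mulr_gt0//= => /eqP/pE.
have ar : antipodal_function r.
  split=> //; have [a _] := @antipodal_four_points R Z; have [b ab] := anti a.
  have ub : ubound (range (fun p : Z * Z => r p.1 p.2)) 1 by move=> _ [p _ <-].
  apply/eqP; rewrite eq_le; apply/andP; split.
    by apply: ge_sup => //; exists (r a b), (a, b).
  by apply: ub_le_sup; [exists 1|exists (a, b)].
have mr : moebius_equivalent r rho0.
  move=> x x' y y' u.
  apply: (@twist_moebius R _ _ rho0 r id D _ _ x x' y y' u) => // z.
  by rewrite gt_eqF.
exists (MoebiusSpace ar mr); apply: ts_eq => z /=.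
rewrite /log_derivative (_ : derivative _ _ = fun z => expR (- f z)) ?expRK ?opprK//.
apply: moebius_derivativeE; split=> [x|x|x y]; first exact: expR_gt0.
  apply: continuous_comp; last exact: continuous_expR.
  by apply: cvgN; exact: ts_continuous.
rewrite /= /r DE exprMn; congr (_ * _).
by rewrite expr2 -!expRD; congr expR; lra.
Qed.

Lemma moebius_space_injective : injective_metric_space (moebius_space Z).
Proof.
apply: (injective_transfer moebius_to_span_isometric moebius_to_span_onto).
exact: tight_span_injective.
Qed.

End MoebiusSpace.

Theorem theorem1p10 (R : realType) :
  (forall X : gromovProductSpace R,
     at_least_four_points (gp_boundary X) ->
     (maximal_gromov_product_space X <-> injective_metric_space X)) /\
  (forall Z : antipodalSpace R, injective_metric_space (moebius_space Z)).
Proof.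
split=> [X Z4|Z]; last exact: moebius_space_injective.
split; first exact: maximal_injective.
by move=> injX Y f mf; exact: (moebius_extends injX Z4 mf).
Qed.
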